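(* Let $n\ge3$, $1<k<n/2$. (i) If $p=p_{so}=\frac{(n+2)k}{n-2k}$, or if $p\ge\max\{p^*,p_{jl}\}$ with $p^*=k\frac{n+2k}{n-2k}$, then every regular solution of (1.6) is a stable solution of (1.1) on $(R,\infty)$ for some $R>0$. (ii) If $p_{se}=\frac{nk}{n-2k}<p<p_{so}$ and $U_s$ is a positive $C^1(0,\infty)$ solution of (1.1) such that $U_s(r)/u_s(r)\to1$ as $r\to0$ and $U_s(r)r^{\frac{n-2k}{k}}\to\lambda$ as $r\to\infty$ for some $\lambda>0$, where $u_s(r)=Ar^{-\frac{2k}{p-k}}$ with $A=(\tfrac1kC_{n-1}^{k-1})^{\frac{1}{p-k}}(\tfrac{2k}{p-k})^{\frac{k}{p-k}}(n-\tfrac{2pk}{p-k})^{\frac{1}{p-k}}$, then $U_s$ is a stable solution of (1.1) on $(R,\infty)$ for some $R>0$.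
   Context: Equation (1.1) is $$-\tfrac{1}{k}C_{n-1}^{k-1}\big(r^{n-k}|u'|^{k-1}u'\big)'=r^{n-1}u^{p},\qquad u(r)>0 \text{ for } r>0,$$ with $C_{n-1}^{k-1}$ the binomial coefficient. Problem (1.6) is (1.1) together with $u'(0)=0$, $u(0)=\rho>0$; a solution of (1.6) is regular if $x\mapsto u(|x|)$ is in $C^2(\mathbb{R}^n)$. The Joseph–Lundgren exponent is $p_{jl}=\infty$ if $n\le 2k+8$, and $p_{jl}=\frac{k[n^2-2(k+3)n+4k]+4k\sqrt{2(k+1)n-4k}}{(n-2k)(n-2k-8)}$ if $n>2k+8$. Let $W_*=\{\varphi:(0,\infty)\to\mathbb{R} : \varphi(|x|)=\phi(x) \text{ for some radial } \phi\in C_c^\infty(\mathbb{R}^n)\}$ and $$Q_u(\varphi):=C_{n-1}^{k-1}\int_0^\infty r^{n-k}|u'|^{k-1}(\varphi')^2dr-p\int_0^\infty r^{n-1}u^{p-1}\varphi^2dr.$$ A positive solution $u\in C^1(0,\infty)$ of (1.1) is stable on $(R,\infty)$ if $\int_0^\infty[\tfrac1k C_{n-1}^{k-1}r^{n-k}|u'|^{k-1}u'\varphi'-r^{n-1}u^p\varphi]dr=0$ for all $\varphi\in W_*$ and $Q_u(\varphi)\ge0$ for all $\varphi\in C_c^\infty(R,\infty)$. *)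

(* Defs.v *)
From Stdlib Require Import Reals Lra Lia List.
Open Scope R_scope.

(** Points of R^n are represented as [x : nat -> R]; only the
    coordinates [x 0 .. x (n-1)] are used. *)

Fixpoint sqsum (n : nat) (x : nat -> R) : R :=
  match n with
  | O => 0
  | S m => sqsum m x + x m ^ 2
  end.

Definition normn (n : nat) (x : nat -> R) : R := sqrt (sqsum n x).

Definition upd (x : nat -> R) (i : nat) (t : R) : nat -> R :=
  fun j => if Nat.eqb j i then t else x j.

Definition continuous_Rn (n : nat) (F : (nat -> R) -> R) : Prop :=
  forall x eps, 0 < eps -> exists delta, 0 < delta /\
    forall y, (forall i, (i < n)%nat -> Rabs (y i - x i) < delta) ->
              (forall i, (n <= i)%nat -> y i = x i) ->
              Rabs (F y - F x) < eps.

(** F is of class C^m on R^n: D l is the iterated partial derivative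
    along the directions listed in l (last applied first). *)
Definition Cm_Rn (n m : nat) (F : (nat -> R) -> R) : Prop :=
  exists D : list nat -> (nat -> R) -> R,
    (forall x, D nil x = F x) /\
    (forall l, (length l <= m)%nat -> continuous_Rn n (D l)) /\
    (forall l i x, (length l < m)%nat -> (i < n)%nat ->
       derivable_pt_lim (fun t => D l (upd x i t)) (x i) (D (i :: l) x)).

Definition smooth_Rn (n : nat) (F : (nat -> R) -> R) : Prop :=
  forall m, Cm_Rn n m F.

(** W_* : restrictions to (0,oo) of radial C_c^oo(R^n) functions:
    phi(|x|) = Phi(x) (for x <> 0, where phi is defined). *)
Definition in_Wstar (n : nat) (phi : R -> R) : Prop :=
  exists Phi : (nat -> R) -> R,
    smooth_Rn n Phi /\
    (exists M, forall x, M < normn n x -> Phi x = 0) /\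
    (forall x, 0 < normn n x -> Phi x = phi (normn n x)).

Definition smooth1 (phi : R -> R) : Prop :=
  exists D : nat -> R -> R, (forall x, D O x = phi x) /\
    forall m x, derivable_pt_lim (D m) x (D (S m) x).

(** C_c^oo(R, oo), functions extended by zero outside (R,oo). *)
Definition Cc_inf_on (R0 : R) (phi : R -> R) : Prop :=
  smooth1 phi /\
  exists a b, R0 < a /\ a < b /\ (forall r, r < a \/ b < r -> phi r = 0).

Definition int_on (f : R -> R) (a b v : R) : Prop :=
  exists pr : Riemann_integrable f a b, RiemannInt pr = v.

(** int_0^oo f = l, for f vanishing for large r, as an (improper at 0)
    Riemann integral: lim_{a->0+} int_a^B f = l. *)
Definition improper_int0 (f : R -> R) (l : R) : Prop :=
  exists B, 0 < B /\ (forall r, B <= r -> f r = 0) /\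
    forall eps, 0 < eps -> exists delta, 0 < delta /\
      forall a, 0 < a -> a < delta -> a < B ->
        exists v, int_on f a B v /\ Rabs (v - l) < eps.

Definition Cnk (n k : nat) : R := C (n - 1) (k - 1).

Definition sol11 (n k : nat) (p : R) (u : R -> R) : Prop :=
  (forall r, 0 < r -> 0 < u r) /\
  exists du : R -> R,
    forall r, 0 < r ->
      derivable_pt_lim u r (du r) /\ continuity_pt du r /\
      derivable_pt_lim (fun s => s ^ (n - k) * Rabs (du s) ^ (k - 1) * du s) r
        (- (INR k / Cnk n k) * (r ^ (n - 1) * Rpower (u r) p)).

Definition regular_sol16 (n k : nat) (p rho : R) (u : R -> R) : Prop :=
  sol11 n k p u /\ u 0 = rho /\
  (forall eps, 0 < eps -> exists delta, 0 < delta /\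
     forall h, 0 < h < delta -> Rabs ((u h - u 0) / h) < eps) /\
  Cm_Rn n 2 (fun x => u (normn n x)).

Definition stable_on (n k : nat) (p : R) (u : R -> R) (R0 : R) : Prop :=
  forall du : R -> R, (forall r, 0 < r -> derivable_pt_lim u r (du r)) ->
  (forall phi dphi, in_Wstar n phi ->
     (forall r, 0 < r -> derivable_pt_lim phi r (dphi r)) ->
     improper_int0 (fun r => / INR k * Cnk n k * r ^ (n - k) * Rabs (du r) ^ (k - 1)
                               * du r * dphi r
                             - r ^ (n - 1) * Rpower (u r) p * phi r) 0) /\
  (forall phi dphi, Cc_inf_on R0 phi ->
     (forall r, derivable_pt_lim phi r (dphi r)) ->
     exists Q, improper_int0 (fun r => Cnk n k * r ^ (n - k) * Rabs (du r) ^ (k - 1)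
                                        * dphi r ^ 2
                                      - p * (r ^ (n - 1) * Rpower (u r) (p - 1) * phi r ^ 2)) Q
               /\ 0 <= Q).

Definition p_se (n k : nat) : R := INR n * INR k / (INR n - 2 * INR k).
Definition p_so (n k : nat) : R := (INR n + 2) * INR k / (INR n - 2 * INR k).
Definition p_star (n k : nat) : R := INR k * (INR n + 2 * INR k) / (INR n - 2 * INR k).
(** Finite value of p_jl (used only when n > 2k+8; otherwise p_jl = oo). *)
Definition p_jl_fin (n k : nat) : R :=
  (INR k * (INR n ^ 2 - 2 * (INR k + 3) * INR n + 4 * INR k)
   + 4 * INR k * sqrt (2 * (INR k + 1) * INR n - 4 * INR k))
  / ((INR n - 2 * INR k) * (INR n - 2 * INR k - 8)).
(** p >= p_jl, with the convention p_jl = oo when n <= 2k+8. *)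
Definition ge_p_jl (n k : nat) (p : R) : Prop :=
  (2 * k + 8 < n)%nat /\ p_jl_fin n k <= p.

Definition A_s (n k : nat) (p : R) : R :=
  Rpower (/ INR k * Cnk n k) (1 / (p - INR k))
  * Rpower (2 * INR k / (p - INR k)) (INR k / (p - INR k))
  * Rpower (INR n - 2 * p * INR k / (p - INR k)) (1 / (p - INR k)).
Definition u_s (n k : nat) (p r : R) : R :=
  A_s n k p * Rpower r (- (2 * INR k / (p - INR k))).

(* Main.v *)
(** A positive solution turns out to be decreasing with flux [z = r^(n-k) v^k], [v = - u'], tending
    to 0 at the origin, which gives the weak formulation.  In the Emden variables [X = r v / u] and
    [Y = r z' / z] the equation becomes the autonomous system
      r X' = X (X + Y / k - (n - 2k) / k),    r Y' = Y (n - p X - Y),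
    and completing the square reduces stability outside a ball to a Riccati inequality
      G ((k - 1) Y / k + (n - 2k) / k - G) + r G' >= (p / k) X Y    for large r.
    If [X <= (n - 2k) / k] and [Y -> 0], the constant [G = (n - 2k) / (2k)] works.  For [p = p_so] this
    follows from Pohozaev's identity, for the singular solution from its decay at infinity.  For
    [p >= p_jl] the equilibrium [(Xs, Ys)] is a node and a regular orbit never crosses [X = Xs]; then
    [u (Xs - X)] is a positive solution of the linearized equation, which is stability. *)

Require Import Defs.
From Stdlib Require Import Reals Lra Lia List.
From Coquelicot Require Import Coquelicot.
Open Scope R_scope.

(** The sign of [u'] and the limit of the flux at the origin are derived, for regular and singular
    solutions alike, from one condition: [u r^((n-2k)/k) -> 0], that is, [u] is negligible against
    the fundamental solution. For the node, real eigenvalues by themselves do not confine the orbit;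
    it is trapped on one side of a line through [(Xs, Ys)] whose slope is the mean of the two
    eigenslopes. The condition [p >= p_jl] is the sign of the discriminant, and [p >= p_so], which
    follows from [p >= p^*], amounts to [Xs <= Ys]; together they make the line steep enough to have
    [(0, n)] on the proper side. *)

(** * Calculus: local derivatives, monotonicity, antiderivatives *)

Lemma derivable_pt_lim_value (f : R -> R) (x l m : R) :
  derivable_pt_lim f x l -> l = m -> derivable_pt_lim f x m.
Proof. now intros H <-. Qed.

Lemma derivable_pt_lim_local_ext (f g : R -> R) (a b x l : R) :
  a < x < b -> (forall y, a < y < b -> f y = g y) ->
  derivable_pt_lim f x l -> derivable_pt_lim g x l.
Proof.
  intros Hx Hfg H; apply is_derive_Reals.
  apply is_derive_ext_loc with f; [|now apply is_derive_Reals].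
  assert (Hd : 0 < Rmin (x - a) (b - x)) by (apply Rmin_pos; lra).
  exists (mkposreal _ Hd); intros y Hy.
  change (Rabs (y - x) < Rmin (x - a) (b - x)) in Hy.
  pose proof (Rmin_l (x - a) (b - x)); pose proof (Rmin_r (x - a) (b - x)).
  apply Hfg; apply Rabs_def2 in Hy; lra.
Qed.

Lemma continuity_pt_local_ext (f g : R -> R) (a b x : R) :
  a < x < b -> (forall y, a < y < b -> f y = g y) ->
  continuity_pt f x -> continuity_pt g x.
Proof.
  intros Hx Hfg H; apply continuity_pt_ext_loc with f; [|exact H].
  assert (Hd : 0 < Rmin (x - a) (b - x)) by (apply Rmin_pos; lra).
  exists (mkposreal _ Hd); intros y Hy.
  change (Rabs (y - x) < Rmin (x - a) (b - x)) in Hy.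
  pose proof (Rmin_l (x - a) (b - x)); pose proof (Rmin_r (x - a) (b - x)).
  apply Hfg; apply Rabs_def2 in Hy; lra.
Qed.

Lemma derivable_pt_lim_continuity (f : R -> R) (x l : R) :
  derivable_pt_lim f x l -> continuity_pt f x.
Proof. intros H; apply derivable_continuous_pt; now exists l. Qed.

Lemma nonneg_derivative_le (f f' : R -> R) (a b : R) :
  a <= b -> (forall x, a <= x <= b -> derivable_pt_lim f x (f' x)) ->
  (forall x, a <= x <= b -> 0 <= f' x) -> f a <= f b.
Proof.
  intros [Hab|<-] Hd Hp; [|lra].
  destruct (MVT_cor2 f f' a b Hab Hd) as [c [Hc Hc']].
  specialize (Hp c ltac:(lra)); nra.
Qed.

Lemma pos_derivative_lt (f f' : R -> R) (a b : R) :
  a < b -> (forall x, a <= x <= b -> derivable_pt_lim f x (f' x)) ->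
  (forall x, a <= x <= b -> 0 < f' x) -> f a < f b.
Proof.
  intros Hab Hd Hp.
  destruct (MVT_cor2 f f' a b Hab Hd) as [c [Hc Hc']].
  specialize (Hp c ltac:(lra)); nra.
Qed.

Lemma nonpos_derivative_le (f f' : R -> R) (a b : R) :
  a <= b -> (forall x, a <= x <= b -> derivable_pt_lim f x (f' x)) ->
  (forall x, a <= x <= b -> f' x <= 0) -> f b <= f a.
Proof.
  intros [Hab|<-] Hd Hp; [|lra].
  destruct (MVT_cor2 f f' a b Hab Hd) as [c [Hc Hc']].
  specialize (Hp c ltac:(lra)); nra.
Qed.

Lemma same_derivative_diff (f g f' : R -> R) (a b : R) :
  a <= b -> (forall x, a <= x <= b -> derivable_pt_lim f x (f' x)) ->
  (forall x, a <= x <= b -> derivable_pt_lim g x (f' x)) ->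
  f b - f a = g b - g a.
Proof.
  intros [Hab|<-] Hf Hg; [|lra].
  destruct (MVT_cor2 (fun x => f x - g x) (fun x => f' x - f' x) a b Hab) as [c [Hc _]].
  - intros x Hx; apply (derivable_pt_lim_minus f g); auto.
  - lra.
Qed.

Lemma int_on_antiderivative (f : R -> R) (a b : R) :
  a <= b -> (forall x, a <= x <= b -> continuity_pt f x) ->
  exists P v, int_on f a b v /\ P b - P a = v /\
    forall x, a <= x <= b -> derivable_pt_lim P x (f x).
Proof.
  intros Hab Hc.
  set (P := primitive Hab (FTC_P1 Hab Hc)).
  assert (Hpr : Riemann_integrable f a b) by now apply continuity_implies_RiemannInt.
  assert (Pb : P b = RiemannInt Hpr).
  { unfold P, primitive.
    destruct (Rle_dec a b) as [H1|]; [|exfalso; lra]; destruct (Rle_dec b b) as [H2|]; [|exfalso; lra].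
    apply RiemannInt_P5. }
  assert (Pa : P a = 0).
  { unfold P, primitive.
    destruct (Rle_dec a a) as [H1|]; [|exfalso; lra]; destruct (Rle_dec a b) as [H2|]; [|exfalso; lra].
    apply RiemannInt_P9. }
  exists P, (RiemannInt Hpr); split; [now exists Hpr|split; [lra|]].
  intros x Hx; now apply RiemannInt_P28.
Qed.

Lemma int_on_derivative (f F : R -> R) (a b : R) :
  a <= b -> (forall x, a <= x <= b -> continuity_pt f x) ->
  (forall x, a <= x <= b -> derivable_pt_lim F x (f x)) ->
  int_on f a b (F b - F a).
Proof.
  intros Hab Hc HF.
  destruct (int_on_antiderivative f a b Hab Hc) as (P & v & Hv & HP & HP').
  now rewrite (same_derivative_diff F P f a b Hab HF HP'), HP.
Qed.

(** * Test functions and the quadratic form *)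

Definition axis_point (t : R) : nat -> R := fun j => if Nat.eqb j 0 then t else 0.

Lemma sqsum_axis (n : nat) (x : nat -> R) (t : R) :
  (1 <= n)%nat -> x 0%nat = t -> (forall j, (0 < j)%nat -> x j = 0) -> sqsum n x = t ^ 2.
Proof.
  intros Hn H0 Hj; destruct n as [|n]; [lia|clear Hn].
  induction n as [|n IH]; [simpl; rewrite H0; ring|].
  change (sqsum (S (S n)) x) with (sqsum (S n) x + x (S n) ^ 2).
  rewrite IH, Hj by lia; ring.
Qed.

Lemma normn_axis (n : nat) (x : nat -> R) (t : R) :
  (1 <= n)%nat -> x 0%nat = t -> (forall j, (0 < j)%nat -> x j = 0) -> 0 <= t -> normn n x = t.
Proof.
  intros Hn H0 Hj Ht; unfold normn; rewrite (sqsum_axis n x t Hn H0 Hj).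
  now apply sqrt_pow2.
Qed.

Lemma continuous_on_axis (n : nat) (F : (nat -> R) -> R) (t : R) :
  (1 <= n)%nat -> continuous_Rn n F -> continuity_pt (fun s => F (axis_point s)) t.
Proof.
  intros Hn HF eps Heps; destruct (HF (axis_point t) eps Heps) as (d & Hd & H).
  exists d; split; [exact Hd|]; intros s [_ Hs]; apply H.
  - intros [|i] _; unfold axis_point; simpl; [exact Hs|].
    rewrite Rminus_diag, Rabs_R0; exact Hd.
  - intros [|i] Hi; [lia|reflexivity].
Qed.

(** A radial function is determined by its restriction to the first axis: there
    [phi t = Phi (t, 0, ..., 0)], so [dphi] is the partial derivative of [Phi] in direction 0 and
    inherits its continuity, while continuity of [Phi] at the origin bounds [phi] near 0. *)
Lemma in_Wstar_test_function (n : nat) (phi dphi : R -> R) :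
  (1 <= n)%nat -> in_Wstar n phi ->
  (forall r, 0 < r -> derivable_pt_lim phi r (dphi r)) ->
  (forall r, 0 < r -> continuity_pt dphi r) /\
  (exists B, 0 < B /\ forall r, B <= r -> phi r = 0 /\ dphi r = 0) /\
  (exists C d, 0 < d /\ forall r, 0 < r < d -> Rabs (phi r) <= C).
Proof.
  intros Hn (Phi & Hsm & (M & HM) & Hphi) Hd.
  destruct (Hsm 1%nat) as (D & HD0 & HDc & HDd).
  assert (Hax : forall x t, 0 < t -> x 0%nat = t -> (forall j, (0 < j)%nat -> x j = 0) ->
            D nil x = phi t).
  { intros x t Ht H0 Hj. pose proof (normn_axis n x t Hn H0 Hj ltac:(lra)) as E.
    rewrite HD0, Hphi; [now rewrite E|lra]. }
  assert (Haxp : forall t, 0 < t -> D nil (axis_point t) = phi t).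
  { intros t Ht; apply Hax; auto; intros [|j] Hj; [lia|reflexivity]. }
  assert (Hdd : forall r, 0 < r -> dphi r = D (0%nat :: nil) (axis_point r)).
  { intros r Hr; apply (uniqueness_limite phi r); [now apply Hd|].
    apply (derivable_pt_lim_local_ext (fun t => D nil (upd (axis_point r) 0 t)) phi 0 (r + 1));
      [lra| |].
    - intros y Hy; apply Hax; [lra|reflexivity|intros [|j] Hj; [lia|reflexivity]].
    - apply (HDd nil 0%nat (axis_point r)); [simpl; lia|lia]. }
  assert (Hvan : forall r, Rmax M 0 < r -> phi r = 0).
  { intros r Hr; pose proof (Rmax_l M 0); pose proof (Rmax_r M 0).
    rewrite <- Haxp by lra. rewrite HD0. apply HM.
    rewrite (normn_axis n (axis_point r) r); [lra|exact Hn|reflexivity| |lra].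
    intros [|j] Hj; [lia|reflexivity]. }
  split; [|split].
  - intros r Hr.
    apply (continuity_pt_local_ext (fun t => D (0%nat :: nil) (axis_point t)) dphi 0 (r + 1));
      [lra|intros y Hy; symmetry; apply Hdd; lra|].
    apply (continuous_on_axis n); [exact Hn|]; apply HDc; simpl; lia.
  (* The [+ 1] gives every [r >= B] a neighbourhood on which [phi] vanishes, so that [dphi] vanishes
     too. *)
  - exists (Rmax M 0 + 1); pose proof (Rmax_r M 0); split; [lra|].
    intros r Hr; split; [apply Hvan; lra|].
    apply (uniqueness_limite phi r); [apply Hd; lra|].
    apply (derivable_pt_lim_local_ext (fun _ => 0) phi (Rmax M 0) (r + 1)); [lra| |].
    + intros y Hy; symmetry; apply Hvan; lra.
    + apply derivable_pt_lim_const.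
  - destruct (HDc nil ltac:(simpl; lia) (axis_point 0) 1 Rlt_0_1) as (d & Hdp & Hb).
    exists (Rabs (D nil (axis_point 0)) + 1), d; split; [exact Hdp|].
    intros r Hr; rewrite <- Haxp by lra.
    assert (Rabs (D nil (axis_point r) - D nil (axis_point 0)) < 1).
    { apply Hb.
      - intros [|i] _; unfold axis_point; simpl.
        + rewrite Rminus_0_r, Rabs_pos_eq; lra.
        + rewrite Rminus_diag, Rabs_R0; exact Hdp.
      - intros [|i] Hi; [lia|reflexivity]. }
    pose proof (Rabs_triang (D nil (axis_point r) - D nil (axis_point 0)) (D nil (axis_point 0))) as T.
    replace (D nil (axis_point r) - D nil (axis_point 0) + D nil (axis_point 0))
      with (D nil (axis_point r)) in T by ring.
    lra.
Qed.

Lemma Cc_inf_on_test_function (R0 : R) (phi dphi : R -> R) :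
  Cc_inf_on R0 phi -> (forall r, derivable_pt_lim phi r (dphi r)) ->
  (forall r, continuity_pt dphi r) /\
  exists a b, R0 < a /\ a < b /\ forall r, r < a \/ b < r -> phi r = 0 /\ dphi r = 0.
Proof.
  intros [(D & HD0 & HD) (a & b & Ha & Hab & Hv)] Hd; split.
  - intros r.
    assert (E : forall s, D 1%nat s = dphi s).
    { intros s; apply (uniqueness_limite phi s); [|apply Hd].
      apply (derivable_pt_lim_local_ext (D 0%nat) phi (s - 1) (s + 1)); [lra|auto|apply HD]. }
    apply (continuity_pt_local_ext (D 1%nat) dphi (r - 1) (r + 1)); [lra|auto|].
    exact (derivable_pt_lim_continuity _ _ _ (HD 1%nat r)).
  - exists a, b; split; [exact Ha|split; [exact Hab|]].
    intros r Hr; split; [now apply Hv|].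
    apply (uniqueness_limite phi r); [apply Hd|].
    destruct Hr as [Hr|Hr].
    + apply (derivable_pt_lim_local_ext (fun _ => 0) phi (r - 1) a); [lra| |apply derivable_pt_lim_const].
      intros y Hy; symmetry; apply Hv; lra.
    + apply (derivable_pt_lim_local_ext (fun _ => 0) phi b (r + 1)); [lra| |apply derivable_pt_lim_const].
      intros y Hy; symmetry; apply Hv; lra.
Qed.

(* The weight [g] comes from completing the square:
   V phi'^2 - W phi^2 + (g phi^2)' = V (phi' + g phi / V)^2 + (g' - g^2/V - W) phi^2. *)
Lemma quadratic_form_nonneg (V W g dg f : R -> R) (R0 : R) (phi dphi : R -> R) :
  0 < R0 ->
  (forall r, 0 < r -> 0 < V r) ->
  (forall r, 0 < r -> continuity_pt V r) -> (forall r, 0 < r -> continuity_pt W r) ->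
  (forall r, R0 <= r -> derivable_pt_lim g r (dg r)) ->
  (forall r, R0 <= r -> W r <= dg r - g r ^ 2 / V r) ->
  Cc_inf_on R0 phi -> (forall r, derivable_pt_lim phi r (dphi r)) ->
  (forall r, f r = V r * dphi r ^ 2 - W r * phi r ^ 2) ->
  exists Q, improper_int0 f Q /\ 0 <= Q.
Proof.
  intros HR0 HV HVc HWc Hg Hineq Hphi Hd Hf.
  destruct (Cc_inf_on_test_function R0 phi dphi Hphi Hd) as [Hdc (a & b & Ha & Hab & Hv)].
  assert (Hfc : forall r, 0 < r -> continuity_pt f r).
  { intros r Hr; pose proof (derivable_pt_lim_continuity _ _ _ (Hd r)).
    apply continuity_pt_ext with (fun r => V r * dphi r ^ 2 - W r * phi r ^ 2);
      [intros s; symmetry; apply Hf|].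
    apply continuity_pt_minus; (apply continuity_pt_mult; [auto|]);
    apply (continuity_pt_comp _ (fun x => x ^ 2)); auto;
    apply derivable_continuous_pt, derivable_pt_pow. }
  (* [b + 1] and not [b]: the vanishing is known only strictly beyond [b]. *)
  destruct (int_on_antiderivative f R0 (b + 1) ltac:(lra)) as (P & v & _ & HPv & HP).
  { intros x Hx; apply Hfc; lra. }
  exists v; split.
  - exists (b + 1); split; [lra|split].
    + intros r Hr; rewrite Hf; destruct (Hv r) as [-> ->]; [lra|ring].
    (* Left of [R0] the integrand is 0, so every lower limit below [R0] gives the same integral. *)
    + intros eps Heps; exists R0; split; [exact HR0|]; intros c Hc1 Hc2 Hc3.
      destruct (int_on_antiderivative f c (b + 1) ltac:(lra)) as (P2 & v2 & Hi & HPv2 & HP2).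
      { intros x Hx; apply Hfc; lra. }
      exists v2; split; [exact Hi|].
      assert (P2 R0 - P2 c = 0).
      { rewrite (same_derivative_diff P2 (fun _ => 0) f c R0); [ring|lra| |].
        - intros x Hx; apply HP2; lra.
        - intros x Hx; apply (derivable_pt_lim_value _ _ 0); [apply derivable_pt_lim_const|].
          rewrite Hf; destruct (Hv x) as [-> ->]; [lra|ring]. }
      assert (P2 (b + 1) - P2 R0 = P (b + 1) - P R0).
      { apply (same_derivative_diff P2 P f); [lra| |exact HP]. intros x Hx; apply HP2; lra. }
      replace (v2 - v) with 0 by lra. rewrite Rabs_R0; exact Heps.
  (* [P + g phi^2] is nondecreasing by the completed square, and [phi] vanishes at both ends of
     [[R0, b + 1]]. *)
  - assert (H : P R0 + g R0 * (phi R0 * phi R0)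
                <= P (b + 1) + g (b + 1) * (phi (b + 1) * phi (b + 1))).
    { apply (nonneg_derivative_le (fun r => P r + g r * (phi r * phi r))
        (fun r => f r + (dg r * (phi r * phi r)
                         + g r * (dphi r * phi r + phi r * dphi r)))); [lra| |].
      - intros x Hx.
        apply (derivable_pt_lim_plus P (fun r => g r * (phi r * phi r))); [now apply HP|].
        apply (derivable_pt_lim_mult g (fun r => phi r * phi r)); [apply Hg; lra|].
        apply (derivable_pt_lim_mult phi phi); apply Hd.
      - intros x Hx; rewrite Hf.
        pose proof (HV x ltac:(lra)) as Vx. pose proof (Hineq x ltac:(lra)) as Hx'.
        replace (_ + _) with (V x * (dphi x + g x * phi x / V x) ^ 2
          + (dg x - g x ^ 2 / V x - W x) * phi x ^ 2) by (field; lra).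
        apply Rplus_le_le_0_compat; apply Rmult_le_pos; try lra; apply pow2_ge_0. }
    destruct (Hv R0 ltac:(lra)) as [E1 _]. destruct (Hv (b + 1) ltac:(lra)) as [E2 _].
    rewrite E1, E2 in H. lra.
Qed.

(** * Sign of the flux, its limit at the origin, and the weak formulation *)

Lemma Rpower_small (beta eps : R) :
  0 < beta -> 0 < eps ->
  exists d, 0 < d /\ forall r, 0 < r < d -> Rpower r beta < eps.
Proof.
  intros Hb He; exists (Rpower eps (/ beta)); split; [apply exp_pos|].
  intros r Hr; replace eps with (Rpower (Rpower eps (/ beta)) beta) at 1.
  - now apply Rlt_Rpower_l.
  - rewrite Rpower_mult, Rinv_l by lra; now apply Rpower_1.
Qed.

Lemma Rpower_pos (x y : R) : 0 < Rpower x y.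
Proof. apply exp_pos. Qed.

Lemma derivable_pt_lim_Rpower (r y : R) :
  0 < r -> derivable_pt_lim (fun x => Rpower x y) r (y * Rpower r (y - 1)).
Proof. intros Hr; now apply derivable_pt_lim_power. Qed.

(** Subtracting the primitive [- (m / beta) r^(- beta)] of the lower bound leaves a nondecreasing
    function, which is bounded above near 0; the factor 2 in [2 * beta] absorbs that bound. *)
Lemma derivative_blowup (f f' : R -> R) (m beta r0 : R) :
  0 < m -> 0 < beta -> 0 < r0 ->
  (forall r, 0 < r <= r0 -> derivable_pt_lim f r (f' r)) ->
  (forall r, 0 < r <= r0 -> m * Rpower r (- (beta + 1)) <= f' r) ->
  exists d, 0 < d /\ forall r, 0 < r < d -> f r * Rpower r beta <= - (m / (2 * beta)).
Proof.
  intros Hm Hb Hr0 Hd Hf'.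
  set (h := fun r => f r + - (m / beta) * (- Rpower r (- beta))).
  assert (Hh : forall r, 0 < r <= r0 -> h r <= h r0).
  { intros r Hr.
    apply (nonneg_derivative_le h
      (fun s => f' s + - (m / beta) * (- (- beta * Rpower s (- beta - 1))))); [lra| |].
    - intros x Hx; apply derivable_pt_lim_plus; [apply Hd; lra|].
      apply (derivable_pt_lim_scal (fun s => - Rpower s (- beta))).
      apply (derivable_pt_lim_opp (fun s => Rpower s (- beta))).
      apply derivable_pt_lim_Rpower; lra.
    - intros x Hx; specialize (Hf' x ltac:(lra)).
      replace (- (beta + 1)) with (- beta - 1) in Hf' by ring.
      replace (- (m / beta) * _) with (- (m * Rpower x (- beta - 1))) by (field; lra). lra. }
  assert (Hmb : 0 < m / (2 * beta)) by (apply Rdiv_lt_0_compat; lra).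
  pose proof (Rabs_pos (h r0)) as HC.
  destruct (Rpower_small beta (m / (2 * beta) / (Rabs (h r0) + 1)) Hb) as (d & Hdp & Hsm).
  { apply Rdiv_lt_0_compat; lra. }
  exists (Rmin d r0); split; [now apply Rmin_pos|]; intros r Hr.
  pose proof (Rmin_l d r0); pose proof (Rmin_r d r0).
  specialize (Hsm r ltac:(lra)); specialize (Hh r ltac:(lra)).
  pose proof (Rpower_pos r beta) as Hp.
  assert (E : Rpower r (- beta) * Rpower r beta = 1).
  { rewrite <- Rpower_plus, Rplus_opp_l; apply Rpower_O; lra. }
  assert (H2 : h r * Rpower r beta <= Rabs (h r0) * Rpower r beta).
  { apply Rmult_le_compat_r; [lra|]. pose proof (Rle_abs (h r0)); lra. }
  assert (H3 : h r * Rpower r beta = f r * Rpower r beta + 2 * (m / (2 * beta))).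
  { unfold h. transitivity (f r * Rpower r beta + m / beta * (Rpower r (- beta) * Rpower r beta));
      [ring|rewrite E; field; lra]. }
  apply (Rmult_lt_compat_r (Rabs (h r0) + 1)) in Hsm; [|lra].
  replace (m / (2 * beta) / (Rabs (h r0) + 1) * (Rabs (h r0) + 1)) with (m / (2 * beta)) in Hsm
    by (field; lra).
  lra.
Qed.

(** This is the k-th root of [d^k >= m r^(k - n)], where [(n - k) / k = (n - 2k) / k + 1]. The
    number [d] is arbitrary so that both [u'] and [- u'] can be inserted. *)
Lemma flux_gradient_bound (n k : nat) (m r d : R) :
  (0 < k)%nat -> (k <= n)%nat -> 0 < r -> 0 < m ->
  m <= r ^ (n - k) * Rabs d ^ (k - 1) * d ->
  Rpower m (/ INR k) * Rpower r (- ((INR n - 2 * INR k) / INR k + 1)) <= d.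
Proof.
  intros Hk Hkn Hr Hm H.
  assert (HK : 0 < INR k) by now apply lt_0_INR.
  assert (Hrp : 0 < r ^ (n - k)) by now apply pow_lt.
  assert (Hd : 0 < d).
  { destruct (Rlt_le_dec 0 d) as [|Hd]; [assumption|].
    assert (0 <= r ^ (n - k) * Rabs d ^ (k - 1)).
    { apply Rmult_le_pos; [lra|apply pow_le, Rabs_pos]. }
    nra. }
  rewrite Rabs_pos_eq in H by lra.
  replace (r ^ (n - k) * d ^ (k - 1) * d) with (r ^ (n - k) * d ^ k) in H.
  2:{ replace k with (S (k - 1)) at 2 by lia. rewrite <- tech_pow_Rmult; ring. }
  set (t := Rpower m (/ INR k) * _).
  destruct (Rle_lt_dec t d) as [|Hlt]; [assumption|exfalso].
  assert (Hpow : d ^ k < t ^ k).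
  { rewrite <- (Rpower_pow k d), <- (Rpower_pow k t) by lra. apply Rlt_Rpower_l; lra. }
  assert (Ht : r ^ (n - k) * t ^ k = m).
  { unfold t; rewrite Rpow_mult_distr.
    rewrite <- (Rpower_pow k (Rpower m _)), <- (Rpower_pow k (Rpower r _)) by apply Rpower_pos.
    rewrite !Rpower_mult, Rinv_l, Rpower_1 by lra.
    rewrite <- (Rpower_pow (n - k)), minus_INR by assumption.
    rewrite Rmult_comm, Rmult_assoc, <- Rpower_plus.
    replace (_ + _) with 0 by (field; lra). rewrite Rpower_O by lra; ring. }
  nra.
Qed.

(** One-sided: the equation constrains nothing below 0, and division and [Rpower] take default
    values at 0. *)
Definition vanishes_at_0 (f : R -> R) : Prop :=
  forall eps, 0 < eps -> exists d, 0 < d /\ forall r, 0 < r < d -> Rabs (f r) < eps.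

(* A nonzero limit of the flux at 0 would make [u] behave like the fundamental
   solution [r ^ (- (n - 2k) / k)], or negative. *)
Lemma flux_negative_vanishing (n k : nat) (u du q : R -> R) :
  (0 < k)%nat -> (2 * k < n)%nat ->
  (forall r, 0 < r -> 0 < u r) ->
  (forall r, 0 < r -> derivable_pt_lim u r (du r)) ->
  (forall r, 0 < r ->
     derivable_pt_lim (fun s => s ^ (n - k) * Rabs (du s) ^ (k - 1) * du s) r (- q r)) ->
  (forall r, 0 < r -> 0 < q r) ->
  vanishes_at_0 (fun r => u r * Rpower r ((INR n - 2 * INR k) / INR k)) ->
  (forall r, 0 < r -> r ^ (n - k) * Rabs (du r) ^ (k - 1) * du r < 0) /\
  vanishes_at_0 (fun s => s ^ (n - k) * Rabs (du s) ^ (k - 1) * du s).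
Proof.
  intros Hk Hn Hu Hdu Hw Hq Hv.
  set (w := fun s => s ^ (n - k) * Rabs (du s) ^ (k - 1) * du s) in *.
  assert (HK : 0 < INR k) by now apply lt_0_INR.
  assert (HN : 2 * INR k < INR n) by (apply lt_INR in Hn; rewrite mult_INR in Hn; simpl in Hn; lra).
  set (beta := (INR n - 2 * INR k) / INR k) in *.
  assert (Hbeta : 0 < beta) by (apply Rdiv_lt_0_compat; lra).
  assert (Hdec : forall a b, 0 < a < b -> w b < w a).
  { intros a b Hab.
    enough (- w a < - w b) by lra.
    apply (pos_derivative_lt (fun r => - w r) q); [lra| |].
    - intros x Hx; apply (derivable_pt_lim_value _ _ (- - q x)); [|ring].
      apply (derivable_pt_lim_opp w), Hw; lra.
    - intros x Hx; apply Hq; lra. }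
  assert (Hnonpos : forall r, 0 < r -> w r <= 0).
  { intros r0 Hr0; destruct (Rle_lt_dec (w r0) 0) as [|Hpos]; [assumption|exfalso].
    (* A positive value persists towards 0 since the flux decreases in [r]; then [u r^beta] would be
       negative near 0. *)
    destruct (derivative_blowup u du (Rpower (w r0) (/ INR k)) beta r0) as (d & Hd & H); auto.
    - apply Rpower_pos.
    - intros r Hr; apply Hdu; lra.
    - intros r Hr; apply (flux_gradient_bound n k (w r0)); try lia; try lra.
      change (w r0 <= w r). destruct (Req_dec r r0) as [->|]; [lra|].
      left; apply Hdec; lra.
    - specialize (H (d / 2) ltac:(lra)).
      pose proof (Hu (d / 2) ltac:(lra)). pose proof (Rpower_pos (d / 2) beta).
      assert (0 < Rpower (w r0) (/ INR k) / (2 * beta))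
        by (apply Rdiv_lt_0_compat; [apply Rpower_pos|lra]).
      assert (0 < u (d / 2) * Rpower (d / 2) beta) by now apply Rmult_lt_0_compat.
      lra. }
  assert (Hneg : forall r, 0 < r -> w r < 0).
  { intros r Hr. apply Rlt_le_trans with (w (r / 2)); [apply Hdec; lra|apply Hnonpos; lra]. }
  split; [exact Hneg|].
  intros m Hm.
  (* By monotonicity one value above [- m] controls the flux all the way to 0. Otherwise the flux is
     at most [- m] everywhere and [u] is at least of order [r^(- beta)], against the vanishing of
     [u r^beta]. *)
  destruct (Classical_Prop.classic (exists d, 0 < d /\ - m < w d)) as [(d & Hd & Hwd)|Hno].
  - exists d; split; [exact Hd|]; intros r Hr.
    change (Rabs (w r) < m).
    pose proof (Hneg r ltac:(lra)); pose proof (Hdec r d ltac:(lra)).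
    apply Rabs_def1; lra.
  - exfalso.
    assert (Hle : forall r, 0 < r -> w r <= - m).
    { intros r Hr; destruct (Rle_lt_dec (w r) (- m)); [assumption|].
      exfalso; apply Hno; now exists r. }
    set (M := Rpower m (/ INR k)). assert (HM : 0 < M) by apply Rpower_pos.
    destruct (derivative_blowup (fun r => - u r) (fun r => - du r) M beta 1)
      as (d & Hd & H); auto; [lra| | |].
    + intros r Hr; apply (derivable_pt_lim_opp u), Hdu; lra.
    + intros r Hr; apply (flux_gradient_bound n k m); try lia; try lra.
      rewrite Rabs_Ropp. specialize (Hle r ltac:(lra)); unfold w in Hle; lra.
    + assert (HMb : 0 < M / (2 * beta)) by (apply Rdiv_lt_0_compat; lra).
      destruct (Hv _ HMb) as (d2 & Hd2 & H2).
      pose proof (Rmin_pos d d2 Hd Hd2); pose proof (Rmin_l d d2); pose proof (Rmin_r d d2).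
      specialize (H (Rmin d d2 / 2) ltac:(lra)); specialize (H2 (Rmin d d2 / 2) ltac:(lra)).
      apply Rabs_def2 in H2; lra.
Qed.

(** The integrand is the exact derivative [c (w phi)'], so the integral from [a] to beyond the
    support is [- c w(a) phi(a)], which tends to 0 because [phi] is bounded near 0 and the flux [w]
    vanishes there. *)
Lemma weak_formulation (n k : nat) (u du q phi dphi f : R -> R) (c : R) :
  (1 <= n)%nat ->
  (forall r, 0 < r -> continuity_pt du r) -> (forall r, 0 < r -> continuity_pt q r) ->
  (forall r, 0 < r ->
     derivable_pt_lim (fun s => s ^ (n - k) * Rabs (du s) ^ (k - 1) * du s) r (- q r)) ->
  vanishes_at_0 (fun s => s ^ (n - k) * Rabs (du s) ^ (k - 1) * du s) ->
  in_Wstar n phi -> (forall r, 0 < r -> derivable_pt_lim phi r (dphi r)) ->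
  (forall r, f r = c * (r ^ (n - k) * Rabs (du r) ^ (k - 1) * du r * dphi r - q r * phi r)) ->
  improper_int0 f 0.
Proof.
  intros Hn Hduc Hqc Hw Hw0 Hphi Hd Hf.
  destruct (in_Wstar_test_function n phi dphi Hn Hphi Hd)
    as (Hdc & (B & HB & Hvan) & (M & d & Hdp & HM)).
  set (w := fun s => s ^ (n - k) * Rabs (du s) ^ (k - 1) * du s) in *.
  exists B; split; [exact HB|split].
  - intros r Hr; rewrite Hf; destruct (Hvan r Hr) as [-> ->]; ring.
  - intros eps Heps.
    assert (HcM : 0 < Rabs c * Rabs M + 1).
    { pose proof (Rmult_le_pos _ _ (Rabs_pos c) (Rabs_pos M)); lra. }
    destruct (Hw0 (eps / (Rabs c * Rabs M + 1))) as (d2 & Hd2 & Hw2);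
      [now apply Rdiv_lt_0_compat|].
    exists (Rmin d d2); split; [now apply Rmin_pos|]; intros a Ha Had HaB.
    pose proof (Rmin_l d d2); pose proof (Rmin_r d d2).
    exists (c * (w B * phi B) - c * (w a * phi a)); split.
    + apply (int_on_derivative f (fun r => c * (w r * phi r))); [lra| |].
      * intros x Hx.
        apply continuity_pt_ext with (fun r => c * (w r * dphi r - q r * phi r));
          [intros s; symmetry; apply Hf|].
        apply continuity_pt_mult; [apply continuity_pt_const; now intros ? ?|].
        apply continuity_pt_minus; apply continuity_pt_mult.
        -- exact (derivable_pt_lim_continuity _ _ _ (Hw x ltac:(lra))).
        -- apply Hdc; lra.
        -- apply Hqc; lra.
        -- exact (derivable_pt_lim_continuity _ _ _ (Hd x ltac:(lra))).
      * intros x Hx; apply (derivable_pt_lim_value _ _ (c * (- q x * phi x + w x * dphi x)));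
          [|rewrite Hf; unfold w; ring].
        apply (derivable_pt_lim_scal (fun r => w r * phi r)).
        apply (derivable_pt_lim_mult w phi); [apply Hw; lra|apply Hd; lra].
    + destruct (Hvan B (Rle_refl B)) as [-> _].
      replace (_ - 0) with (- (c * phi a * w a)) by ring.
      rewrite Rabs_Ropp, !Rabs_mult.
      specialize (Hw2 a ltac:(lra)); specialize (HM a ltac:(lra)).
      apply (Rmult_lt_compat_r _ _ _ HcM) in Hw2.
      replace (eps / _ * _) with eps in Hw2 by (field; lra).
      pose proof (Rle_abs M); pose proof (Rabs_pos c); pose proof (Rabs_pos (w a)).
      change (Rabs (w a) * (Rabs c * Rabs M + 1) < eps) in Hw2.
      assert (Rabs c * Rabs (phi a) * Rabs (w a) <= Rabs c * Rabs M * Rabs (w a)).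
      { apply Rmult_le_compat_r; [lra|]; apply Rmult_le_compat_l; lra. }
      lra.
Qed.

(** * Logarithmic derivatives and the Emden system *)

(** The form [f' = f a] turns the rules for products, quotients and powers into linear rules for
    [a], by which [X], [Y], the flux and the coefficient of the quadratic form are all
    differentiated. *)
Definition log_derivative (f : R -> R) (r a : R) : Prop :=
  derivable_pt_lim f r (f r * a).

Lemma log_derivative_value (f : R -> R) (r a b : R) :
  log_derivative f r a -> a = b -> log_derivative f r b.
Proof. now intros H <-. Qed.

Lemma log_derivative_mult (f g : R -> R) (r a b : R) :
  log_derivative f r a -> log_derivative g r b ->
  log_derivative (fun x => f x * g x) r (a + b).
Proof.
  intros Hf Hg; apply (derivable_pt_lim_value _ _ (f r * a * g r + f r * (g r * b))); [|ring].
  now apply (derivable_pt_lim_mult f g).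
Qed.

Lemma log_derivative_inv (f : R -> R) (r a : R) :
  f r <> 0 -> log_derivative f r a -> log_derivative (fun x => / f x) r (- a).
Proof.
  intros Hz Hf; apply is_derive_Reals.
  replace (/ f r * - a) with (- (f r * a) / f r ^ 2) by (field; exact Hz).
  apply is_derive_inv; [now apply is_derive_Reals|exact Hz].
Qed.

Lemma log_derivative_div (f g : R -> R) (r a b : R) :
  g r <> 0 -> log_derivative f r a -> log_derivative g r b ->
  log_derivative (fun x => f x / g x) r (a - b).
Proof.
  intros Hz Hf Hg; apply (log_derivative_mult f (fun x => / g x)); [exact Hf|].
  now apply log_derivative_inv.
Qed.

Lemma log_derivative_pow (f : R -> R) (m : nat) (r a : R) :
  log_derivative f r a -> log_derivative (fun x => f x ^ m) r (INR m * a).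
Proof.
  intros Hf; apply (derivable_pt_lim_value _ _ (INR m * f r ^ pred m * (f r * a))).
  - apply (derivable_pt_lim_comp f (fun y => y ^ m)); [exact Hf|apply derivable_pt_lim_pow].
  - destruct m as [|m]; [simpl; ring|]. simpl pred; rewrite <- tech_pow_Rmult; ring.
Qed.

Lemma log_derivative_Rpower (f : R -> R) (y r a : R) :
  0 < f r -> log_derivative f r a -> log_derivative (fun x => Rpower (f x) y) r (y * a).
Proof.
  intros Hp Hf; apply (derivable_pt_lim_value _ _ (y * Rpower (f r) (y - 1) * (f r * a))).
  - apply (derivable_pt_lim_comp f (fun z => Rpower z y)); [exact Hf|].
    now apply derivable_pt_lim_power.
  - replace (Rpower (f r) y) with (Rpower (f r) (y - 1) * f r); [ring|].
    rewrite <- (Rpower_1 (f r)) at 2 by exact Hp. rewrite <- Rpower_plus; f_equal; ring.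
Qed.

Lemma log_derivative_id (r : R) : r <> 0 -> log_derivative (fun x => x) r (/ r).
Proof.
  intros Hr; apply (derivable_pt_lim_value _ _ 1); [apply derivable_pt_lim_id|now field].
Qed.

Lemma log_derivative_const (c r : R) : log_derivative (fun _ => c) r 0.
Proof.
  apply (derivable_pt_lim_value _ _ 0); [apply derivable_pt_lim_const|ring].
Qed.

Definition emden_X (u v : R -> R) (r : R) : R := r * v r / u r.
(** This is [r z' / z] with [z' = K r^(n-1) u^p] and [z = r^(n-k) v^k] inserted. [X] and [Y]
    generalize the homology invariants of the Lane-Emden equation. *)
Definition emden_Y (k : nat) (p K : R) (u v : R -> R) (r : R) : R :=
  K * r ^ k * Rpower (u r) p / v r ^ k.

(* A positive decreasing solution, with [v = - u'] and [K = k / C_{n-1}^{k-1}]. *)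
Record profile (n k : nat) (p K : R) (u v : R -> R) : Prop := {
  profile_u_pos : forall r, 0 < r -> 0 < u r;
  profile_v_pos : forall r, 0 < r -> 0 < v r;
  profile_u_derive : forall r, 0 < r -> derivable_pt_lim u r (- v r);
  profile_v_derive : forall r, 0 < r ->
    log_derivative v r ((emden_Y k p K u v r - (INR n - INR k)) / (INR k * r))
}.

Lemma profile_u_log (n k : nat) (p K : R) (u v : R -> R) (r : R) :
  profile n k p K u v -> 0 < r -> log_derivative u r (- emden_X u v r / r).
Proof.
  intros H Hr; pose proof (profile_u_pos _ _ _ _ _ _ H r Hr).
  apply (derivable_pt_lim_value _ _ (- v r)); [now apply (profile_u_derive _ _ _ _ _ _ H)|].
  unfold emden_X; field; lra.
Qed.

Lemma emden_X_pos (n k : nat) (p K : R) (u v : R -> R) (r : R) :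
  profile n k p K u v -> 0 < r -> 0 < emden_X u v r.
Proof.
  intros H Hr; pose proof (profile_u_pos _ _ _ _ _ _ H r Hr).
  pose proof (profile_v_pos _ _ _ _ _ _ H r Hr).
  apply Rdiv_lt_0_compat; [now apply Rmult_lt_0_compat|assumption].
Qed.

Lemma emden_Y_pos (n k : nat) (p K : R) (u v : R -> R) (r : R) :
  profile n k p K u v -> 0 < K -> 0 < r -> 0 < emden_Y k p K u v r.
Proof.
  intros H HK Hr; pose proof (profile_v_pos _ _ _ _ _ _ H r Hr).
  apply Rdiv_lt_0_compat; [|now apply pow_lt].
  apply Rmult_lt_0_compat; [|apply Rpower_pos].
  apply Rmult_lt_0_compat; [assumption|now apply pow_lt].
Qed.

Lemma emden_X_derive (n k : nat) (p K : R) (u v : R -> R) (r : R) :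
  profile n k p K u v -> (0 < k)%nat -> 0 < r ->
  log_derivative (emden_X u v) r
    ((emden_X u v r + emden_Y k p K u v r / INR k - (INR n - 2 * INR k) / INR k) / r).
Proof.
  intros H Hk Hr; pose proof (profile_u_pos _ _ _ _ _ _ H r Hr).
  assert (HK : 0 < INR k) by now apply lt_0_INR.
  eapply log_derivative_value.
  - apply (log_derivative_div (fun x => x * v x) u); [lra| |exact (profile_u_log _ _ _ _ _ _ _ H Hr)].
    apply log_derivative_mult; [apply log_derivative_id; lra|].
    exact (profile_v_derive _ _ _ _ _ _ H r Hr).
  - field; lra.
Qed.

Lemma emden_Y_derive (n k : nat) (p K : R) (u v : R -> R) (r : R) :
  profile n k p K u v -> (0 < k)%nat -> 0 < r ->
  log_derivative (emden_Y k p K u v) r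
    ((INR n - p * emden_X u v r - emden_Y k p K u v r) / r).
Proof.
  intros H Hk Hr; pose proof (profile_u_pos _ _ _ _ _ _ H r Hr).
  pose proof (profile_v_pos _ _ _ _ _ _ H r Hr).
  assert (HK : 0 < INR k) by now apply lt_0_INR.
  eapply log_derivative_value.
  - apply (log_derivative_div (fun x => K * x ^ k * Rpower (u x) p) (fun x => v x ^ k)).
    + apply pow_nonzero; lra.
    + apply (log_derivative_mult (fun x => K * x ^ k)).
      * apply log_derivative_mult; [apply log_derivative_const|].
        apply log_derivative_pow, log_derivative_id; lra.
      * apply log_derivative_Rpower; [assumption|exact (profile_u_log _ _ _ _ _ _ _ H Hr)].
    + apply log_derivative_pow; exact (profile_v_derive _ _ _ _ _ _ H r Hr).
  - field; lra.
Qed.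

Lemma flux_log_derivative (n k : nat) (p K : R) (u v : R -> R) (r : R) :
  profile n k p K u v -> (0 < k)%nat -> (k <= n)%nat -> 0 < r ->
  log_derivative (fun s => s ^ (n - k) * v s ^ k) r (emden_Y k p K u v r / r).
Proof.
  intros H Hk Hkn Hr; assert (HK : 0 < INR k) by now apply lt_0_INR.
  eapply log_derivative_value.
  - apply (log_derivative_mult (fun s => s ^ (n - k)) (fun s => v s ^ k)); apply log_derivative_pow.
    + apply log_derivative_id; lra.
    + exact (profile_v_derive _ _ _ _ _ _ H r Hr).
  - rewrite minus_INR by assumption. field; lra.
Qed.

Lemma Cnk_pos (n k : nat) : 0 < Cnk n k.
Proof.
  apply Rdiv_lt_0_compat; [apply INR_fact_lt_0|].
  apply Rmult_lt_0_compat; apply INR_fact_lt_0.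
Qed.

(** Only the flux [w] is assumed differentiable, not [u']. Since [w < 0], the gradient is recovered
    as [v = (- w r^(k - n))^(1/k)], a power of a positive differentiable function, so [v']
    exists. *)
Lemma profile_of_negative_flux (n k : nat) (p K : R) (u du : R -> R) :
  (0 < k)%nat -> (k < n)%nat ->
  (forall r, 0 < r -> 0 < u r) ->
  (forall r, 0 < r -> derivable_pt_lim u r (du r)) ->
  (forall r, 0 < r ->
     derivable_pt_lim (fun s => s ^ (n - k) * Rabs (du s) ^ (k - 1) * du s) r
       (- (K * (r ^ (n - 1) * Rpower (u r) p)))) ->
  (forall r, 0 < r -> r ^ (n - k) * Rabs (du r) ^ (k - 1) * du r < 0) ->
  profile n k p K u (fun r => - du r).
Proof.
  intros Hk Hkn Hu Hdu Hw Hneg.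
  set (w := fun s => s ^ (n - k) * Rabs (du s) ^ (k - 1) * du s) in *.
  assert (HK : 0 < INR k) by now apply lt_0_INR.
  assert (Hv : forall r, 0 < r -> 0 < - du r).
  { intros r Hr; specialize (Hneg r Hr).
    assert (0 <= r ^ (n - k) * Rabs (du r) ^ (k - 1)).
    { apply Rmult_le_pos; [left; now apply pow_lt|apply pow_le, Rabs_pos]. }
    unfold w in Hneg; nra. }
  assert (Hwv : forall r, 0 < r -> - w r = r ^ (n - k) * (- du r) ^ k).
  { intros r Hr; specialize (Hv r Hr); unfold w. rewrite Rabs_left by lra.
    replace ((- du r) ^ k) with (- du r * (- du r) ^ (k - 1))
      by (rewrite tech_pow_Rmult; f_equal; lia). ring. }
  assert (Hvw : forall r, 0 < r ->
            Rpower (- w r * Rpower r (- (INR n - INR k))) (/ INR k) = - du r).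
  { intros r Hr; specialize (Hv r Hr); rewrite Hwv by exact Hr.
    rewrite <- (Rpower_pow (n - k) r), <- (Rpower_pow k) by lra.
    rewrite minus_INR by lia.
    rewrite (Rmult_comm (Rpower r _)), Rmult_assoc, <- Rpower_plus, Rplus_opp_r, Rpower_O by lra.
    rewrite Rmult_1_r, Rpower_mult, Rinv_r by lra. now apply Rpower_1. }
  constructor; [exact Hu|exact Hv| |].
  - intros r Hr; rewrite Ropp_involutive; auto.
  - intros r Hr.
    apply (derivable_pt_lim_local_ext
      (fun r => Rpower (- w r * Rpower r (- (INR n - INR k))) (/ INR k)) _ 0 (r + 1)); [lra| |].
    { intros y Hy; apply Hvw; lra. }
    rewrite <- Hvw at 1 by exact Hr.
    change (log_derivative (fun r => Rpower (- w r * Rpower r (- (INR n - INR k))) (/ INR k)) r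
      ((emden_Y k p K u (fun r => - du r) r - (INR n - INR k)) / (INR k * r))).
    specialize (Hv r Hr); pose proof (Hneg r Hr : w r < 0).
    assert (0 < - w r) by lra.
    eapply log_derivative_value.
    + apply (log_derivative_Rpower (fun r => - w r * Rpower r (- (INR n - INR k)))).
      * apply Rmult_lt_0_compat; [assumption|apply Rpower_pos].
      * apply (log_derivative_mult (fun r => - w r)).
        -- apply (derivable_pt_lim_value _ _ (- - (K * (r ^ (n - 1) * Rpower (u r) p)))).
           ++ apply (derivable_pt_lim_opp w); auto.
           ++ instantiate (1 := emden_Y k p K u (fun r => - du r) r / r).
              rewrite Hwv by exact Hr; unfold emden_Y.
              replace (n - 1)%nat with (n - k + (k - 1))%nat by lia. rewrite pow_add.
              replace (r ^ k) with (r * r ^ (k - 1)) by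
                (rewrite tech_pow_Rmult; f_equal; lia).
              assert (HD : (- du r) ^ k <> 0) by (apply pow_nonzero; lra).
              revert HD; generalize ((- du r) ^ k); intros D HD. field; lra.
        -- apply log_derivative_Rpower; [exact Hr|apply log_derivative_id; lra].
    + field; lra.
Qed.

(* [G] is [r g / V] for the weight [g] of [quadratic_form_nonneg]. *)
Lemma stable_of_riccati (n k : nat) (p R0 : R) (u du G dG phi dphi : R -> R) :
  profile n k p (INR k / Cnk n k) u (fun r => - du r) ->
  (0 < k)%nat -> (k < n)%nat -> 0 < R0 ->
  (forall r, R0 <= r -> derivable_pt_lim G r (dG r)) ->
  (forall r, R0 <= r ->
     let X := emden_X u (fun r => - du r) r in
     let Y := emden_Y k p (INR k / Cnk n k) u (fun r => - du r) r in
     p / INR k * (X * Y)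
     <= G r * ((INR k - 1) / INR k * Y + (INR n - 2 * INR k) / INR k - G r) + r * dG r) ->
  Cc_inf_on R0 phi -> (forall r, derivable_pt_lim phi r (dphi r)) ->
  exists Q, improper_int0 (fun r => Cnk n k * r ^ (n - k) * Rabs (du r) ^ (k - 1) * dphi r ^ 2
                            - p * (r ^ (n - 1) * Rpower (u r) (p - 1) * phi r ^ 2)) Q
            /\ 0 <= Q.
Proof.
  intros H Hk Hkn HR0 HG Hineq Hphi Hd.
  set (c := Cnk n k) in *; assert (Hc : 0 < c) by apply Cnk_pos.
  set (v := fun r => - du r) in *. set (K := INR k / c) in *.
  assert (HK : 0 < INR k) by now apply lt_0_INR.
  set (V := fun r => c * r ^ (n - k) * Rabs (du r) ^ (k - 1)).
  assert (Hv : forall r, 0 < r -> 0 < v r) by exact (profile_v_pos _ _ _ _ _ _ H).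
  assert (HVv : forall r, 0 < r -> c * r ^ (n - k) * v r ^ (k - 1) = V r).
  { intros r Hr; specialize (Hv r Hr); unfold V, v in *. now rewrite Rabs_left by lra. }
  assert (HVpos : forall r, 0 < r -> 0 < V r).
  { intros r Hr; rewrite <- HVv by exact Hr.
    apply Rmult_lt_0_compat; [apply Rmult_lt_0_compat; [exact Hc|]|]; apply pow_lt; auto. }
  assert (HVd : forall r, 0 < r ->
    log_derivative V r (((INR n - INR k) / INR k + (INR k - 1) / INR k * emden_Y k p K u v r) / r)).
  { intros r Hr; unfold log_derivative; rewrite <- HVv at 1 by exact Hr.
    apply (derivable_pt_lim_local_ext (fun r => c * r ^ (n - k) * v r ^ (k - 1)) V 0 (r + 1));
      [lra|intros y Hy; apply HVv; lra|].
    change (log_derivative (fun r => c * r ^ (n - k) * v r ^ (k - 1)) r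
      (((INR n - INR k) / INR k + (INR k - 1) / INR k * emden_Y k p K u v r) / r)).
    eapply log_derivative_value.
    - apply (log_derivative_mult (fun r => c * r ^ (n - k)) (fun r => v r ^ (k - 1))).
      + apply log_derivative_mult; [apply log_derivative_const|].
        apply log_derivative_pow, log_derivative_id; lra.
      + apply log_derivative_pow; exact (profile_v_derive _ _ _ _ _ _ H r Hr).
    - rewrite !minus_INR by lia. simpl (INR 1). field; lra. }
  (* With [g = V G / r] and the logarithmic derivative of [V], [g' - g^2 / V] is [V / r^2] times the
     right-hand side of the Riccati inequality, and the potential is [V / r^2] times its left-hand
     side. *)
  apply (quadratic_form_nonneg V (fun r => p * (r ^ (n - 1) * Rpower (u r) (p - 1)))
    (fun r => V r * / r * G r)
    (fun r => V r * / r * (((INR n - INR k) / INR k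
        + (INR k - 1) / INR k * emden_Y k p K u v r) / r + - / r) * G r + V r * / r * dG r)
    _ R0 phi dphi); auto.
  - intros r Hr; exact (derivable_pt_lim_continuity _ _ _ (HVd r Hr)).
  - intros r Hr. eapply derivable_pt_lim_continuity.
    apply (log_derivative_mult (fun _ => p)); [apply log_derivative_const|].
    apply log_derivative_mult.
    + apply log_derivative_pow, log_derivative_id; lra.
    + apply log_derivative_Rpower; [now apply (profile_u_pos _ _ _ _ _ _ H)|].
      exact (profile_u_log _ _ _ _ _ _ _ H Hr).
  - intros r Hr; apply (derivable_pt_lim_mult (fun r => V r * / r) G); [|auto].
    apply (log_derivative_mult V (fun r => / r)); [apply HVd; lra|].
    apply (log_derivative_inv (fun r => r)); [lra|apply log_derivative_id; lra].
  - intros r Hr; specialize (Hineq r Hr); cbv zeta in Hineq.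
    assert (Hr' : 0 < r) by lra.
    pose proof (HVpos r Hr') as HVr.
    assert (HW : p * (r ^ (n - 1) * Rpower (u r) (p - 1))
      = V r / r ^ 2 * (p / INR k * (emden_X u v r * emden_Y k p K u v r))).
    { rewrite <- HVv by exact Hr'. unfold emden_X, emden_Y, K.
      pose proof (profile_u_pos _ _ _ _ _ _ H r Hr') as Hu. specialize (Hv r Hr').
      replace (Rpower (u r) p) with (Rpower (u r) (p - 1) * u r).
      2:{ rewrite <- (Rpower_1 (u r)) at 2 by exact Hu. rewrite <- Rpower_plus; f_equal; ring. }
      replace (n - 1)%nat with (n - k + (k - 1))%nat by lia. rewrite pow_add.
      replace (r ^ k) with (r * r ^ (k - 1)) by (rewrite tech_pow_Rmult; f_equal; lia).
      replace (v r ^ k) with (v r * v r ^ (k - 1)) by (rewrite tech_pow_Rmult; f_equal; lia).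
      field. repeat split; try lra. apply pow_nonzero; lra. }
    rewrite HW.
    apply Rle_trans with (V r / r ^ 2 * (G r * ((INR k - 1) / INR k * emden_Y k p K u v r
      + (INR n - 2 * INR k) / INR k - G r) + r * dG r)).
    + apply Rmult_le_compat_l; [|exact Hineq].
      left; apply Rdiv_lt_0_compat; [exact HVr|now apply pow_lt].
    + right; field; lra.
  - intros r; unfold V; ring.
Qed.

(** * From solutions of the equation to criteria for stability *)

Lemma INR_dimension_gap (n k : nat) : (2 * k < n)%nat -> 2 * INR k < INR n.
Proof. intros H; apply lt_INR in H; rewrite mult_INR in H; simpl in H; lra. Qed.

(** [stable_on] quantifies over every derivative [du] of [u], whereas [sol11] provides one with an
    equation; uniqueness of derivatives on [(0, oo)] transfers it. *)
Lemma sol11_gradient (n k : nat) (p : R) (u du : R -> R) :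
  (0 < k)%nat -> sol11 n k p u -> (forall r, 0 < r -> derivable_pt_lim u r (du r)) ->
  (forall r, 0 < r -> continuity_pt du r) /\
  (forall r, 0 < r ->
     derivable_pt_lim (fun s => s ^ (n - k) * Rabs (du s) ^ (k - 1) * du s) r
       (- (INR k / Cnk n k * (r ^ (n - 1) * Rpower (u r) p)))).
Proof.
  intros Hk [Hu (du0 & H0)] Hdu.
  assert (E : forall r, 0 < r -> du0 r = du r).
  { intros r Hr; apply (uniqueness_limite u r); [now apply H0|now apply Hdu]. }
  split; intros r Hr; destruct (H0 r Hr) as (_ & Hc & Hw).
  - apply (continuity_pt_local_ext du0 du 0 (r + 1)); [lra|intros y Hy; apply E; lra|exact Hc].
  - apply (derivable_pt_lim_local_ext
      (fun s => s ^ (n - k) * Rabs (du0 s) ^ (k - 1) * du0 s) _ 0 (r + 1)); [lra| |].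
    + intros y Hy; now rewrite E by lra.
    + apply (derivable_pt_lim_value _ _ _ _ Hw); ring.
Qed.

Lemma sol11_flux (n k : nat) (p : R) (u du : R -> R) :
  (0 < k)%nat -> (2 * k < n)%nat -> sol11 n k p u ->
  (forall r, 0 < r -> derivable_pt_lim u r (du r)) ->
  vanishes_at_0 (fun r => u r * Rpower r ((INR n - 2 * INR k) / INR k)) ->
  (forall r, 0 < r -> r ^ (n - k) * Rabs (du r) ^ (k - 1) * du r < 0) /\
  vanishes_at_0 (fun s => s ^ (n - k) * Rabs (du s) ^ (k - 1) * du s).
Proof.
  intros Hk Hn Hsol Hdu Hv; destruct (sol11_gradient n k p u du Hk Hsol Hdu) as [_ Hw].
  apply (flux_negative_vanishing n k u du
    (fun r => INR k / Cnk n k * (r ^ (n - 1) * Rpower (u r) p))); auto.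
  - apply Hsol.
  - intros r Hr; apply Rmult_lt_0_compat.
    + apply Rdiv_lt_0_compat; [now apply lt_0_INR|apply Cnk_pos].
    + apply Rmult_lt_0_compat; [now apply pow_lt|apply Rpower_pos].
Qed.

Lemma profile_of_sol11 (n k : nat) (p : R) (u : R -> R) :
  (0 < k)%nat -> (2 * k < n)%nat -> sol11 n k p u ->
  vanishes_at_0 (fun r => u r * Rpower r ((INR n - 2 * INR k) / INR k)) ->
  exists v, profile n k p (INR k / Cnk n k) u v /\
    vanishes_at_0 (fun r => r ^ (n - k) * v r ^ k).
Proof.
  intros Hk Hn Hsol Hv; pose proof Hsol as [Hu (du & H0)].
  assert (Hdu : forall r, 0 < r -> derivable_pt_lim u r (du r)) by (intros r Hr; now apply H0).
  destruct (sol11_gradient n k p u du Hk Hsol Hdu) as [_ Hw].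
  destruct (sol11_flux n k p u du Hk Hn Hsol Hdu Hv) as [Hneg Hz].
  assert (Hp : profile n k p (INR k / Cnk n k) u (fun r => - du r))
    by (apply profile_of_negative_flux; auto; lia).
  exists (fun r => - du r); split; [exact Hp|].
  intros eps He; destruct (Hz eps He) as (d & Hd & H); exists d; split; [exact Hd|].
  intros r Hr; specialize (H r Hr).
  pose proof (profile_v_pos _ _ _ _ _ _ Hp r ltac:(lra)) as Hvr; cbv beta in Hvr.
  replace (r ^ (n - k) * (- du r) ^ k) with (- (r ^ (n - k) * Rabs (du r) ^ (k - 1) * du r)).
  - now rewrite Rabs_Ropp.
  - rewrite (Rabs_left (du r)) by lra.
    replace ((- du r) ^ k) with (- du r * (- du r) ^ (k - 1))
      by (rewrite tech_pow_Rmult; f_equal; lia). ring.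
Qed.

Lemma stable_on_of_riccati (n k : nat) (p R0 : R) (u v G dG : R -> R) :
  (0 < k)%nat -> (2 * k < n)%nat -> 0 < R0 -> sol11 n k p u ->
  vanishes_at_0 (fun r => u r * Rpower r ((INR n - 2 * INR k) / INR k)) ->
  profile n k p (INR k / Cnk n k) u v ->
  (forall r, R0 <= r -> derivable_pt_lim G r (dG r)) ->
  (forall r, R0 <= r ->
     let X := emden_X u v r in
     let Y := emden_Y k p (INR k / Cnk n k) u v r in
     p / INR k * (X * Y)
     <= G r * ((INR k - 1) / INR k * Y + (INR n - 2 * INR k) / INR k - G r) + r * dG r) ->
  stable_on n k p u R0.
Proof.
  intros Hk Hn HR0 Hsol Hvan Hp HG Hineq du Hdu.
  pose proof (Cnk_pos n k) as Hc. assert (HK : 0 < INR k) by now apply lt_0_INR.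
  destruct (sol11_gradient n k p u du Hk Hsol Hdu) as [Hduc Hw].
  destruct (sol11_flux n k p u du Hk Hn Hsol Hdu Hvan) as [Hneg Hz].
  split.
  - intros phi dphi Hphi Hd.
    apply (weak_formulation n k u du
      (fun r => INR k / Cnk n k * (r ^ (n - 1) * Rpower (u r) p)) phi dphi _ (/ INR k * Cnk n k));
      auto; [lia| |].
    + intros r Hr. eapply derivable_pt_lim_continuity.
      apply (log_derivative_mult (fun _ => INR k / Cnk n k)); [apply log_derivative_const|].
      apply log_derivative_mult.
      * apply log_derivative_pow, log_derivative_id; lra.
      * apply log_derivative_Rpower; [now apply Hsol|exact (profile_u_log _ _ _ _ _ _ _ Hp Hr)].
    + intros r; field; lra.
  - intros phi dphi Hphi Hd.
    apply (stable_of_riccati n k p R0 u du G dG phi dphi); auto; [|lia|].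
    + apply profile_of_negative_flux; auto; [lia|apply Hsol].
    + intros r Hr; specialize (Hineq r Hr).
      assert (E : - du r = v r).
      { enough (du r = - v r) by lra.
        apply (uniqueness_limite u r); [apply Hdu; lra|].
        apply (profile_u_derive _ _ _ _ _ _ Hp); lra. }
      unfold emden_X, emden_Y in *; cbv beta; rewrite E; exact Hineq.
Qed.

(** With [G0 = (n - 2k) / (2k)], the quantity [G (2 G0 - G)] is largest at [G = G0], with value
    [G0^2]; the threshold [(n - 2k) / (4 p)] for [Y] is the one for which [X <= 2 G0] gives
    [(p / k) X Y <= G0^2]. The term with [(k - 1) / k] is nonnegative. *)
Lemma stable_on_of_small_Y (n k : nat) (p R0 : R) (u v : R -> R) :
  (0 < k)%nat -> (2 * k < n)%nat -> 0 < p -> 0 < R0 -> sol11 n k p u ->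
  vanishes_at_0 (fun r => u r * Rpower r ((INR n - 2 * INR k) / INR k)) ->
  profile n k p (INR k / Cnk n k) u v ->
  (forall r, R0 <= r -> emden_X u v r <= (INR n - 2 * INR k) / INR k) ->
  (forall r, R0 <= r ->
     emden_Y k p (INR k / Cnk n k) u v r <= (INR n - 2 * INR k) / (4 * p)) ->
  stable_on n k p u R0.
Proof.
  intros Hk Hn Hp0 HR0 Hsol Hvan Hp HX HY.
  set (G := (INR n - 2 * INR k) / (2 * INR k)).
  assert (HK : 1 <= INR k) by (apply (le_INR 1); lia).
  pose proof (INR_dimension_gap n k Hn) as HN.
  apply (stable_on_of_riccati n k p R0 u v (fun _ => G) (fun _ => 0)); auto.
  - intros r Hr; apply derivable_pt_lim_const.
  - intros r Hr X Y; specialize (HX r Hr); specialize (HY r Hr).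
    assert (HK' : 0 < INR k / Cnk n k) by (apply Rdiv_lt_0_compat; [lra|apply Cnk_pos]).
    pose proof (emden_X_pos n k p _ u v r Hp ltac:(lra)) as X0.
    pose proof (emden_Y_pos n k p _ u v r Hp HK' ltac:(lra)) as Y0.
    fold X in X0, HX; fold Y in Y0, HY.
    assert (H1 : X * Y <= (INR n - 2 * INR k) / INR k * ((INR n - 2 * INR k) / (4 * p)))
      by (apply Rmult_le_compat; lra).
    assert (HG : 0 < G) by (apply Rdiv_lt_0_compat; lra).
    assert (H2 : 0 <= G * ((INR k - 1) / INR k * Y)).
    { apply Rmult_le_pos; [lra|]; apply Rmult_le_pos; [apply Rdiv_le_0_compat|]; lra. }
    assert (H3 : p / INR k * (X * Y) <= G * G).
    { replace (G * G) with (p / INR k * ((INR n - 2 * INR k) / INR k * ((INR n - 2 * INR k) / (4 * p))))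
        by (unfold G; field; lra).
      apply Rmult_le_compat_l; [|exact H1]. left; apply Rdiv_lt_0_compat; lra. }
    assert (E : (INR n - 2 * INR k) / INR k = 2 * G) by (unfold G; field; lra).
    rewrite E; nra.
Qed.

(** * Comparison arguments and decay at infinity *)

Lemma power_decay (f a : R -> R) (s r1 : R) :
  0 < r1 -> (forall r, r1 <= r -> 0 < f r) ->
  (forall r, r1 <= r -> log_derivative f r (a r / r)) ->
  (forall r, r1 <= r -> a r <= - s) ->
  forall r, r1 <= r -> f r * Rpower r s <= f r1 * Rpower r1 s.
Proof.
  intros Hr1 Hf Hd Ha r Hr.
  apply (nonpos_derivative_le (fun x => f x * Rpower x s)
    (fun x => f x * Rpower x s * (a x / x + s * / x))); [exact Hr| |].
  - intros x Hx; apply (log_derivative_mult f (fun x => Rpower x s)); [apply Hd; lra|].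
    apply log_derivative_Rpower; [lra|apply log_derivative_id; lra].
  - intros x Hx; specialize (Hf x ltac:(lra)); specialize (Ha x ltac:(lra)).
    pose proof (Rpower_pos x s).
    assert (0 < f x * Rpower x s) by now apply Rmult_lt_0_compat.
    replace (a x / x + s * / x) with (- ((- s - a x) * / x)) by (field; lra).
    assert (0 < / x) by (apply Rinv_0_lt_compat; lra).
    assert (0 <= (- s - a x) * / x) by (apply Rmult_le_pos; lra).
    nra.
Qed.

Lemma Rpower_small_at_infinity (s eps : R) :
  0 < s -> 0 < eps -> exists M, 0 < M /\ forall r, M < r -> Rpower r (- s) < eps.
Proof.
  intros Hs He; destruct (Rpower_small s eps Hs He) as (d & Hd & H).
  exists (/ d); split; [now apply Rinv_0_lt_compat|]; intros r Hr.
  assert (0 < / d) by now apply Rinv_0_lt_compat.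
  replace (Rpower r (- s)) with (Rpower (/ r) s).
  - apply H; split; [apply Rinv_0_lt_compat; lra|].
    rewrite <- (Rinv_inv d); apply Rinv_lt_contravar; [nra|exact Hr].
  - unfold Rpower; rewrite ln_Rinv by lra; f_equal; ring.
Qed.

(** The integrating factor [exp (- P)], with [P' = phi], makes [e exp (- P)] nondecreasing. It
    serves to show that a barrier is never reached, whatever the sign of [phi]. *)
Lemma gronwall_pos (e e' phi : R -> R) (a b : R) :
  a <= b -> (forall x, a <= x <= b -> derivable_pt_lim e x (e' x)) ->
  (forall x, a <= x <= b -> continuity_pt phi x) ->
  (forall x, a <= x <= b -> phi x * e x <= e' x) -> 0 < e a -> 0 < e b.
Proof.
  intros Hab He Hphi Hineq Ha.
  destruct (int_on_antiderivative phi a b Hab Hphi) as (P & _ & _ & _ & HP).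
  assert (H : e a * exp (- P a) <= e b * exp (- P b)).
  { apply (nonneg_derivative_le (fun x => e x * exp (- P x))
      (fun x => e' x * exp (- P x) + e x * (exp (- P x) * - phi x))); [exact Hab| |].
    - intros x Hx; apply (derivable_pt_lim_mult e (fun x => exp (- P x))); [auto|].
      apply (derivable_pt_lim_comp (fun x => - P x) exp); [|apply derivable_pt_lim_exp].
      apply (derivable_pt_lim_opp P); auto.
    - intros x Hx; specialize (Hineq x Hx); pose proof (exp_pos (- P x)); nra. }
  pose proof (exp_pos (- P a)); pose proof (exp_pos (- P b)).
  assert (0 < e a * exp (- P a)) by now apply Rmult_lt_0_compat. nra.
Qed.

(** The contact point is the supremum of the points up to which [f] is positive; if [f] were
    positive there, continuity would push the supremum further. *)
Lemma first_nonpositive (f : R -> R) (a b : R) :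
  a <= b -> (forall x, a <= x <= b -> continuity_pt f x) -> 0 < f a -> f b <= 0 ->
  exists c, a < c <= b /\ f c <= 0 /\ forall x, a <= x < c -> 0 < f x.
Proof.
  intros Hab Hc Ha Hb.
  set (E := fun x => a <= x <= b /\ forall y, a <= y <= x -> 0 < f y).
  assert (Ea : E a) by (split; [lra|intros y Hy; now replace y with a by lra]).
  destruct (completeness E) as [c [Hub Hlub]].
  - exists b; now intros x [Hx _].
  - now exists a.
  - assert (Hac : a <= c) by now apply Hub.
    assert (Hcb : c <= b) by (apply Hlub; now intros x [Hx _]).
    assert (Hbelow : forall x, a <= x < c -> 0 < f x).
    { intros x Hx; destruct (Rlt_le_dec 0 (f x)) as [|Hn]; [assumption|exfalso].
      assert (c <= x); [|lra]. apply Hlub; intros y [Hy Hy'].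
      destruct (Rle_lt_dec y x) as [|Hxy]; [assumption|].
      specialize (Hy' x ltac:(lra)); lra. }
    destruct (Rlt_le_dec 0 (f c)) as [Hpos|Hneg].
    + exfalso; destruct (Hc c ltac:(lra) (f c) Hpos) as (d & Hd & H).
      assert (Hcb' : c < b) by (destruct Hcb as [|<-]; [assumption|lra]).
      assert (Hm : 0 < Rmin (d / 2) (b - c)) by (apply Rmin_pos; lra).
      pose proof (Rmin_l (d / 2) (b - c)); pose proof (Rmin_r (d / 2) (b - c)).
      assert (c + Rmin (d / 2) (b - c) <= c); [|lra].
      apply Hub; split; [lra|]; intros y Hy.
      destruct (Rlt_le_dec y c) as [|Hcy]; [apply Hbelow; lra|].
      destruct Hcy as [Hcy|<-]; [|exact Hpos].
      specialize (H y); simpl in H; unfold R_dist in H.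
      assert (Hd' : Rabs (f y - f c) < f c).
      { apply H; split; [split; [exact I|lra]|]. apply Rabs_def1; lra. }
      apply Rabs_def2 in Hd'; lra.
    + exists c; repeat split; auto.
      destruct Hac as [|<-]; [assumption|lra].
Qed.

Lemma emden_X_continuity (n k : nat) (p K : R) (u v : R -> R) (r : R) :
  profile n k p K u v -> (0 < k)%nat -> 0 < r -> continuity_pt (emden_X u v) r.
Proof.
  intros H Hk Hr; exact (derivable_pt_lim_continuity _ _ _ (emden_X_derive _ _ _ _ _ _ _ H Hk Hr)).
Qed.

Lemma emden_Y_continuity (n k : nat) (p K : R) (u v : R -> R) (r : R) :
  profile n k p K u v -> (0 < k)%nat -> 0 < r -> continuity_pt (emden_Y k p K u v) r.
Proof.
  intros H Hk Hr; exact (derivable_pt_lim_continuity _ _ _ (emden_Y_derive _ _ _ _ _ _ _ H Hk Hr)).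
Qed.

Lemma continuity_pt_over_id (f : R -> R) (r : R) :
  r <> 0 -> continuity_pt f r -> continuity_pt (fun x => f x / x) r.
Proof.
  intros Hr Hf; apply (continuity_pt_div f (fun x => x)); auto.
  apply derivable_continuous_pt, derivable_pt_id.
Qed.

(* If [X] exceeded [(n - 2k) / k] it would increase from then on, and [u] would decay
   faster than [r ^ (- (n - 2k) / k)]. *)
Lemma emden_X_le_of_slow_decay (n k : nat) (p K m M : R) (u v : R -> R) :
  profile n k p K u v -> (0 < k)%nat -> 0 < K -> 0 < m ->
  (forall r, M < r -> m <= u r * Rpower r ((INR n - 2 * INR k) / INR k)) ->
  forall r, 0 < r -> emden_X u v r <= (INR n - 2 * INR k) / INR k.
Proof.
  intros H Hk HK Hm Hlow r1 Hr1; set (beta := (INR n - 2 * INR k) / INR k) in *.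
  assert (Hk0 : 0 < INR k) by now apply lt_0_INR.
  set (X := emden_X u v) in *; set (Y := emden_Y k p K u v).
  assert (HX0 : forall r, 0 < r -> 0 < X r) by (intros r Hr; now apply (emden_X_pos n k p K)).
  assert (HY0 : forall r, 0 < r -> 0 < Y r) by (intros r Hr; now apply (emden_Y_pos n k p K)).
  assert (HXd : forall r, 0 < r -> derivable_pt_lim X r (X r * ((X r + Y r / INR k - beta) / r)))
    by (intros r Hr; now apply emden_X_derive).
  destruct (Rle_lt_dec (X r1) beta) as [|Hgt]; [assumption|exfalso].
  (* The derivative of [X - beta] is [X / r] times itself plus the positive term [X Y / (k r)], so
     it cannot return to 0. *)
  assert (Hbig : forall r, r1 <= r -> beta < X r).
  { intros r Hr; enough (0 < X r - beta) by lra.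
    apply (gronwall_pos (fun x => X x - beta)
      (fun x => X x * ((X x + Y x / INR k - beta) / x)) (fun x => X x / x) r1 r); auto; [| | |lra].
    - intros x Hx; apply (derivable_pt_lim_value _ _ (X x * ((X x + Y x / INR k - beta) / x) - 0));
        [|ring].
      apply (derivable_pt_lim_minus X (fun _ => beta)); [apply HXd; lra|apply derivable_pt_lim_const].
    - intros x Hx; apply continuity_pt_over_id; [lra|].
      apply (emden_X_continuity n k p K); auto; lra.
    - intros x Hx; specialize (HX0 x ltac:(lra)); specialize (HY0 x ltac:(lra)).
      replace (X x * ((X x + Y x / INR k - beta) / x))
        with (X x / x * (X x - beta) + X x * Y x / (INR k * x)) by (field; lra).
      assert (0 < X x * Y x / (INR k * x))
        by (apply Rdiv_lt_0_compat; apply Rmult_lt_0_compat; lra). lra. }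
  assert (Hinc : forall r, r1 <= r -> X r1 <= X r).
  { intros r Hr; apply (nonneg_derivative_le X (fun x => X x * ((X x + Y x / INR k - beta) / x))); auto.
    - intros x Hx; apply HXd; lra.
    - intros x Hx; specialize (HX0 x ltac:(lra)); specialize (HY0 x ltac:(lra)).
      specialize (Hbig x ltac:(lra)).
      assert (0 < Y x / INR k) by (apply Rdiv_lt_0_compat; lra).
      left; apply Rmult_lt_0_compat; [lra|]; apply Rdiv_lt_0_compat; lra. }
  (* Since [X] stays above [X r1], [u r^(X r1)] is nonincreasing; as [X r1 > beta], [u r^beta] tends
     to 0 and falls below [m]. *)
  pose proof (power_decay u (fun r => - X r) (X r1) r1 Hr1) as Hdec.
  assert (HC : 0 < u r1 * Rpower r1 (X r1)).
  { apply Rmult_lt_0_compat; [now apply (profile_u_pos _ _ _ _ _ _ H)|apply Rpower_pos]. }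
  destruct (Rpower_small_at_infinity (X r1 - beta) (m / (u r1 * Rpower r1 (X r1))))
    as (M2 & HM2 & Hs); [lra|now apply Rdiv_lt_0_compat|].
  set (r := Rmax r1 (Rmax M M2) + 1).
  pose proof (Rmax_l r1 (Rmax M M2)); pose proof (Rmax_r r1 (Rmax M M2)).
  pose proof (Rmax_l M M2); pose proof (Rmax_r M M2).
  assert (Hr : r = Rmax r1 (Rmax M M2) + 1) by reflexivity; clearbody r.
  specialize (Hs r ltac:(lra)). specialize (Hlow r ltac:(lra)).
  assert (Hrr : r1 <= r) by lra.
  specialize (Hdec ltac:(intros x Hx; apply (profile_u_pos _ _ _ _ _ _ H); lra)
    ltac:(intros x Hx; apply (profile_u_log n k p K); auto; lra)
    ltac:(intros x Hx; specialize (Hinc x Hx); lra) r Hrr).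
  assert (E : u r * Rpower r beta = u r * Rpower r (X r1) * Rpower r (- (X r1 - beta))).
  { rewrite Rmult_assoc, <- Rpower_plus; do 2 f_equal; ring. }
  pose proof (Rpower_pos r (- (X r1 - beta))).
  assert (u r * Rpower r beta <= u r1 * Rpower r1 (X r1) * Rpower r (- (X r1 - beta)))
    by (rewrite E; apply Rmult_le_compat_r; lra).
  apply (Rmult_lt_compat_l _ _ _ HC) in Hs.
  pose proof (Rpower_pos r1 (X r1)). pose proof (profile_u_pos _ _ _ _ _ _ H r1 Hr1).
  replace (_ * (m / _)) with m in Hs by (field; lra). lra.
Qed.

Lemma flux_increasing (n k : nat) (p K : R) (u v : R -> R) (a b : R) :
  profile n k p K u v -> (0 < k)%nat -> (k <= n)%nat -> 0 < K -> 0 < a <= b ->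
  a ^ (n - k) * v a ^ k <= b ^ (n - k) * v b ^ k.
Proof.
  intros H Hk Hkn HK Hab.
  apply (nonneg_derivative_le (fun s => s ^ (n - k) * v s ^ k)
    (fun r => r ^ (n - k) * v r ^ k * (emden_Y k p K u v r / r))); [lra| |].
  - intros x Hx; apply flux_log_derivative; auto; lra.
  - intros x Hx; pose proof (emden_Y_pos n k p K u v x H HK ltac:(lra)).
    pose proof (profile_v_pos _ _ _ _ _ _ H x ltac:(lra)).
    apply Rmult_le_pos; [apply Rmult_le_pos; apply pow_le; lra|].
    left; apply Rdiv_lt_0_compat; lra.
Qed.

Lemma emden_Y_flux (n k : nat) (p K : R) (u v : R -> R) (r : R) :
  (k <= n)%nat -> 0 < r -> 0 < v r ->
  emden_Y k p K u v r * (r ^ (n - k) * v r ^ k) = K * (r ^ n * Rpower (u r) p).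
Proof.
  intros Hkn Hr Hv; unfold emden_Y.
  replace (r ^ n) with (r ^ (n - k) * r ^ k) by (rewrite <- pow_add; f_equal; lia).
  field; apply pow_nonzero; lra.
Qed.

(** In [Y z = K r^n u^p] the flux [z] is at least its value at 1, and [u <= C r^(- beta)] with
    [beta = (n - 2k) / k]. The resulting bound of order [r^(n - beta p)] decays exactly when
    [p > p_se]. *)
Lemma emden_Y_small_of_fast_decay (n k : nat) (p K C M eps : R) (u v : R -> R) :
  profile n k p K u v -> (0 < k)%nat -> (2 * k < n)%nat -> 0 < K -> p_se n k < p ->
  (forall r, M < r -> u r * Rpower r ((INR n - 2 * INR k) / INR k) <= C) ->
  0 < eps -> exists M2, 0 < M2 /\ forall r, M2 < r -> emden_Y k p K u v r <= eps.
Proof.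
  intros H Hk Hn HK Hse Hup He.
  pose proof (INR_dimension_gap n k Hn) as HN. assert (Hk0 : 0 < INR k) by now apply lt_0_INR.
  set (beta := (INR n - 2 * INR k) / INR k) in *.
  assert (Hbeta : 0 < beta) by (apply Rdiv_lt_0_compat; lra).
  assert (Hs : 0 < beta * p - INR n).
  { apply (Rmult_lt_compat_l _ _ _ Hbeta) in Hse. 
    replace (beta * p_se n k) with (INR n) in Hse by (unfold p_se, beta; field; lra). lra. }
  assert (Hp : 0 < p) by (pose proof (lt_0_INR n ltac:(lia)); nra).
  set (z1 := 1 ^ (n - k) * v 1 ^ k).
  assert (Hz1 : 0 < z1).
  { pose proof (profile_v_pos _ _ _ _ _ _ H 1 Rlt_0_1).
    apply Rmult_lt_0_compat; apply pow_lt; lra. }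
  set (D := Rmax C 1). assert (HD : 0 < D) by (pose proof (Rmax_r C 1); unfold D; lra).
  pose proof (Rpower_pos D p) as HDp.
  destruct (Rpower_small_at_infinity (beta * p - INR n) (eps * z1 / (K * Rpower D p)))
    as (M2 & HM2 & Hsm); [exact Hs| |].
  { apply Rdiv_lt_0_compat; apply Rmult_lt_0_compat; assumption. }
  exists (Rmax 1 (Rmax M M2)).
  pose proof (Rmax_l 1 (Rmax M M2)); pose proof (Rmax_r 1 (Rmax M M2)).
  pose proof (Rmax_l M M2); pose proof (Rmax_r M M2).
  split; [lra|]; intros r Hr.
  specialize (Hup r ltac:(lra)); specialize (Hsm r ltac:(lra)).
  assert (Hr0 : 0 < r) by lra.
  pose proof (profile_u_pos _ _ _ _ _ _ H r Hr0) as Hu.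
  pose proof (profile_v_pos _ _ _ _ _ _ H r Hr0) as Hv.
  pose proof (emden_Y_pos n k p K u v r H HK Hr0) as HY.
  pose proof (emden_Y_flux n k p K u v r ltac:(lia) Hr0 Hv) as HYz.
  assert (Hz : z1 <= r ^ (n - k) * v r ^ k) by (apply (flux_increasing n k p K u v); auto; [lia|lra]).
  assert (Hpow : r ^ n * Rpower (u r) p <= Rpower D p * Rpower r (- (beta * p - INR n))).
  { replace (r ^ n * Rpower (u r) p)
      with (Rpower (u r * Rpower r beta) p * Rpower r (- (beta * p - INR n))).
    - apply Rmult_le_compat_r; [left; apply Rpower_pos|].
      apply Rle_Rpower_l; [lra|split].
      + apply Rmult_lt_0_compat; [exact Hu|apply Rpower_pos].
      + unfold D; pose proof (Rmax_l C 1); lra.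
    - rewrite <- Rpower_mult_distr by (try apply Rpower_pos; exact Hu).
      rewrite Rpower_mult, Rmult_assoc, <- Rpower_plus.
      replace (_ + _) with (INR n) by ring. rewrite Rpower_pow by exact Hr0; ring. }
  apply Rmult_le_reg_r with z1; [exact Hz1|].
  apply Rle_trans with (K * (r ^ n * Rpower (u r) p)).
  { rewrite <- HYz; apply Rmult_le_compat_l; lra. }
  apply Rle_trans with (K * (Rpower D p * Rpower r (- (beta * p - INR n))));
    [apply Rmult_le_compat_l; lra|].
  apply (Rmult_lt_compat_l (K * Rpower D p)) in Hsm; [|now apply Rmult_lt_0_compat].
  replace (_ * (_ / _)) with (eps * z1) in Hsm by (field; lra). lra.
Qed.

(** * Orbits issuing from the origin: Pohozaev's identity and the invariant region *)

Lemma vanishes_dominated (f g : R -> R) (C d : R) :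
  0 < d -> (forall r, 0 < r < d -> Rabs (f r) <= C * Rabs (g r)) ->
  vanishes_at_0 g -> vanishes_at_0 f.
Proof.
  intros Hd Hfg Hg eps He.
  pose proof (Rabs_pos C) as HC0; pose proof (Rle_abs C) as HC.
  destruct (Hg (eps / (Rabs C + 1))) as (d2 & Hd2 & H); [apply Rdiv_lt_0_compat; lra|].
  exists (Rmin d d2); split; [now apply Rmin_pos|]; intros r Hr.
  pose proof (Rmin_l d d2); pose proof (Rmin_r d d2).
  specialize (Hfg r ltac:(lra)); specialize (H r ltac:(lra)).
  apply (Rmult_lt_compat_r (Rabs C + 1)) in H; [|lra].
  replace (eps / _ * _) with eps in H by (field; lra).
  pose proof (Rabs_pos (g r)). nra.
Qed.

Lemma vanishes_id : vanishes_at_0 (fun r => r).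
Proof.
  intros eps He; exists eps; split; [exact He|]; intros r Hr; rewrite Rabs_pos_eq; lra.
Qed.

Lemma vanishes_minus (f g : R -> R) :
  vanishes_at_0 f -> vanishes_at_0 g -> vanishes_at_0 (fun r => f r - g r).
Proof.
  intros Hf Hg eps He.
  destruct (Hf (eps / 2) ltac:(lra)) as (d1 & Hd1 & H1).
  destruct (Hg (eps / 2) ltac:(lra)) as (d2 & Hd2 & H2).
  exists (Rmin d1 d2); split; [now apply Rmin_pos|]; intros r Hr.
  pose proof (Rmin_l d1 d2); pose proof (Rmin_r d1 d2).
  specialize (H1 r ltac:(lra)); specialize (H2 r ltac:(lra)).
  pose proof (Rabs_triang (f r) (- g r)) as T; rewrite Rabs_Ropp in T.
  unfold Rminus; lra.
Qed.

Lemma pow_le_id (r : R) (n : nat) : (1 <= n)%nat -> 0 < r < 1 -> r ^ n <= r.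
Proof.
  intros Hn Hr; replace n with (S (n - 1)) by lia; rewrite <- tech_pow_Rmult.
  pose proof (pow_incr r 1 (n - 1) ltac:(lra)) as H; rewrite pow1 in H. nra.
Qed.

(** Stands in for integrating [h'] from 0: were [h r] negative, monotonicity would keep [h] below
    [h r] all the way to 0. *)
Lemma nonneg_of_vanishing_increasing (h h' : R -> R) :
  (forall r, 0 < r -> derivable_pt_lim h r (h' r)) -> (forall r, 0 < r -> 0 <= h' r) ->
  vanishes_at_0 h -> forall r, 0 < r -> 0 <= h r.
Proof.
  intros Hd Hp Hv r Hr; destruct (Rle_lt_dec 0 (h r)) as [|Hneg]; [assumption|exfalso].
  destruct (Hv (- h r) ltac:(lra)) as (d & Hd0 & H).
  pose proof (Rmin_pos d r Hd0 Hr); pose proof (Rmin_l d r); pose proof (Rmin_r d r).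
  specialize (H (Rmin d r / 2) ltac:(lra)); apply Rabs_def2 in H.
  assert (h (Rmin d r / 2) <= h r); [|lra].
  apply (nonneg_derivative_le h h'); [lra| |]; intros x Hx; [apply Hd|apply Hp]; lra.
Qed.

Lemma profile_u_decreasing (n k : nat) (p K : R) (u v : R -> R) (a b : R) :
  profile n k p K u v -> 0 < a <= b -> u b <= u a.
Proof.
  intros H Hab; apply (nonpos_derivative_le u (fun r => - v r)); [lra| |]; intros x Hx.
  - apply (profile_u_derive _ _ _ _ _ _ H); lra.
  - pose proof (profile_v_pos _ _ _ _ _ _ H x ltac:(lra)); lra.
Qed.

(** Boundedness of [u] and vanishing flux are the traces of regularity at the origin from which
    [X -> 0] and [Y <= n] follow. *)
Record profile_at_0 (n k : nat) (p K M : R) (u v : R -> R) : Prop := {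
  profile_at_0_profile : profile n k p K u v;
  profile_at_0_bound : forall r, 0 < r -> u r <= M;
  profile_at_0_flux : vanishes_at_0 (fun r => r ^ (n - k) * v r ^ k)
}.

(** [u] decreases, so [z(r)], the integral of [K s^(n-1) u(s)^p] over [(0, r)], is at least
    [K r^n u(r)^p / n = Y z / n]. In differential form: the difference has derivative
    [K r^(n-1) u^p p X / n >= 0]. *)
Lemma emden_Y_le_dimension (n k : nat) (p K M : R) (u v : R -> R) (r : R) :
  profile_at_0 n k p K M u v -> (0 < k)%nat -> (k <= n)%nat -> 0 < K -> 0 < p -> 0 < r ->
  emden_Y k p K u v r <= INR n.
Proof.
  intros [H Hb Hz] Hk Hkn HK Hp Hr.
  assert (Hn : 0 < INR n) by (apply lt_0_INR; lia).
  set (X := emden_X u v); set (Y := emden_Y k p K u v).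
  set (z := fun r => r ^ (n - k) * v r ^ k) in *.
  assert (HYz : forall x, 0 < x -> Y x * z x = K * (x ^ n * Rpower (u x) p)).
  { intros x Hx; apply emden_Y_flux; auto; now apply (profile_v_pos _ _ _ _ _ _ H). }
  assert (Hh : 0 <= z r - K / INR n * (r ^ n * Rpower (u r) p)).
  { apply (nonneg_of_vanishing_increasing (fun r => z r - K / INR n * (r ^ n * Rpower (u r) p))
      (fun r => z r * (Y r / r) - K / INR n * (r ^ n * Rpower (u r) p)
                                  * (0 + (INR n * / r + p * (- X r / r))))); [| | |exact Hr].
    - intros x Hx.
      apply (derivable_pt_lim_minus z (fun r => K / INR n * (r ^ n * Rpower (u r) p)));
        [now apply flux_log_derivative|].
      apply (log_derivative_mult (fun _ => K / INR n) (fun r => r ^ n * Rpower (u r) p));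
        [apply log_derivative_const|].
      apply (log_derivative_mult (fun r => r ^ n) (fun r => Rpower (u r) p)); [apply log_derivative_pow, log_derivative_id; lra|].
      apply log_derivative_Rpower; [now apply (profile_u_pos _ _ _ _ _ _ H)|].
      now apply (profile_u_log n k p K).
    - intros x Hx; pose proof (emden_X_pos n k p K u v x H Hx) as HX; fold X in HX.
      replace (_ - _) with (/ x * (Y x * z x - K * (x ^ n * Rpower (u x) p))
        + K * (x ^ n * Rpower (u x) p) * (p * X x) / (INR n * x)) by (field; lra).
      rewrite HYz by exact Hx. rewrite Rminus_diag, Rmult_0_r, Rplus_0_l.
      left; apply Rdiv_lt_0_compat; [|now apply Rmult_lt_0_compat].
      apply Rmult_lt_0_compat; [|now apply Rmult_lt_0_compat].
      apply Rmult_lt_0_compat; [exact HK|].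
      apply Rmult_lt_0_compat; [now apply pow_lt|apply Rpower_pos].
    - apply vanishes_minus; [exact Hz|].
      apply (vanishes_dominated _ (fun r => r) (K / INR n * Rpower M p) 1); [lra| |apply vanishes_id].
      intros x Hx.
      assert (0 < K / INR n) by now apply Rdiv_lt_0_compat.
      pose proof (pow_le_id x n ltac:(lia) Hx). pose proof (pow_lt x n ltac:(lra)).
      pose proof (Rpower_pos (u x) p).
      assert (Rpower (u x) p <= Rpower M p).
      { apply Rle_Rpower_l; [lra|split; [apply (profile_u_pos _ _ _ _ _ _ H)|apply Hb]; lra]. }
      rewrite !Rabs_pos_eq; try lra.
      + rewrite Rmult_assoc; apply Rmult_le_compat_l; [lra|].
        rewrite (Rmult_comm (Rpower M p)); apply Rmult_le_compat; lra.
      + apply Rmult_le_pos; [lra|]; apply Rmult_le_pos; lra. }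
  specialize (HYz r Hr).
  assert (Hzr : 0 < z r).
  { apply Rmult_lt_0_compat; apply pow_lt; [exact Hr|now apply (profile_v_pos _ _ _ _ _ _ H)]. }
  apply Rmult_le_reg_r with (z r); [exact Hzr|]. fold (Y r); rewrite HYz.
  replace (K / INR n * (r ^ n * Rpower (u r) p))
    with (K * (r ^ n * Rpower (u r) p) / INR n) in Hh by (field; lra).
  apply Rmult_le_reg_l with (/ INR n); [now apply Rinv_0_lt_compat|].
  replace (/ INR n * (INR n * z r)) with (z r) by (field; lra). lra.
Qed.

(** Bounding [u] by [M] in [z' = K r^(n-1) u^p] gives [z <= c r^n], hence [v] of order [r], and [X]
    is of order [r^2] since [u >= u 1] on [(0, 1)]. *)
Lemma emden_X_vanishes (n k : nat) (p K M : R) (u v : R -> R) :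
  profile_at_0 n k p K M u v -> (0 < k)%nat -> (k <= n)%nat -> 0 < K -> 0 < p ->
  vanishes_at_0 (emden_X u v).
Proof.
  intros [H Hb Hz] Hk Hkn HK Hp.
  assert (Hn : 0 < INR n) by (apply lt_0_INR; lia).
  set (Y := emden_Y k p K u v).
  set (z := fun r => r ^ (n - k) * v r ^ k) in *.
  set (c := K * Rpower M p / INR n).
  assert (Hc : 0 < c).
  { apply Rdiv_lt_0_compat; [apply Rmult_lt_0_compat; [exact HK|apply Rpower_pos]|exact Hn]. }
  assert (HYz : forall x, 0 < x -> Y x * z x = K * (x ^ n * Rpower (u x) p)).
  { intros x Hx; apply emden_Y_flux; auto; now apply (profile_v_pos _ _ _ _ _ _ H). }
  assert (Hzc : forall r, 0 < r -> z r <= c * r ^ n).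
  { intros r Hr; enough (0 <= c * r ^ n - z r) by lra.
    apply (nonneg_of_vanishing_increasing (fun r => c * r ^ n - z r)
      (fun r => c * r ^ n * (0 + INR n * / r) - z r * (Y r / r))); [| | |exact Hr].
    - intros x Hx; apply (derivable_pt_lim_minus (fun r => c * r ^ n) z);
        [|now apply flux_log_derivative].
      apply (log_derivative_mult (fun _ => c) (fun r => r ^ n)); [apply log_derivative_const|].
      apply log_derivative_pow, log_derivative_id; lra.
    - intros x Hx.
      replace (_ - _) with (/ x * (K * Rpower M p * x ^ n - Y x * z x))
        by (unfold c; field; lra).
      rewrite HYz by exact Hx.
      assert (Rpower (u x) p <= Rpower M p).
      { apply Rle_Rpower_l; [lra|split; [now apply (profile_u_pos _ _ _ _ _ _ H)|now apply Hb]]. }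
      apply Rmult_le_pos; [left; now apply Rinv_0_lt_compat|].
      replace (_ - _) with (K * x ^ n * (Rpower M p - Rpower (u x) p)) by ring.
      pose proof (pow_lt x n Hx).
      apply Rmult_le_pos; [apply Rmult_le_pos|]; lra.
    - apply vanishes_minus; [|exact Hz].
      apply (vanishes_dominated _ (fun r => r) c 1); [lra| |apply vanishes_id].
      intros x Hx; pose proof (pow_le_id x n ltac:(lia) Hx). pose proof (pow_lt x n ltac:(lra)).
      rewrite Rabs_mult, !Rabs_pos_eq by lra. apply Rmult_le_compat_l; lra. }
  (* The factor [1 + c] replaces the k-th root of [c]: being at least 1, it satisfies
     [(1 + c)^k >= 1 + c > c]. *)
  assert (Hv : forall r, 0 < r -> v r <= (1 + c) * r).
  { intros r Hr; destruct (Rle_lt_dec (v r) ((1 + c) * r)) as [|Hlt]; [assumption|exfalso].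
    specialize (Hzc r Hr).
    assert (H1 : ((1 + c) * r) ^ k < v r ^ k).
    { assert (0 < (1 + c) * r) by (apply Rmult_lt_0_compat; lra).
      rewrite <- !Rpower_pow by lra. apply Rlt_Rpower_l; [now apply lt_0_INR|lra]. }
    assert (H2 : 1 + c <= (1 + c) ^ k).
    { rewrite <- (pow_1 (1 + c)) at 1; apply Rle_pow; [lra|lia]. }
    rewrite Rpow_mult_distr in H1. pose proof (pow_lt r k Hr). pose proof (pow_lt r (n - k) Hr).
    unfold z in Hzc; replace (r ^ n) with (r ^ (n - k) * r ^ k) in Hzc
      by (rewrite <- pow_add; f_equal; lia).
    assert (c * r ^ k < v r ^ k) by nra. nra. }
  pose proof (profile_u_pos _ _ _ _ _ _ H 1 Rlt_0_1) as Hu1.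
  apply (vanishes_dominated _ (fun r => r) ((1 + c) / u 1) 1); [lra| |apply vanishes_id].
  intros r Hr; specialize (Hv r ltac:(lra)).
  pose proof (profile_v_pos _ _ _ _ _ _ H r ltac:(lra)).
  pose proof (profile_u_decreasing n k p K u v r 1 H ltac:(lra)) as Hu.
  pose proof (emden_X_pos n k p K u v r H ltac:(lra)).
  rewrite !Rabs_pos_eq by lra.
  apply Rle_trans with (r * v r / u 1).
  - unfold emden_X, Rdiv; apply Rmult_le_compat_l; [apply Rmult_le_pos; lra|].
    apply Rinv_le_contravar; lra.
  - replace ((1 + c) / u 1 * r) with ((1 + c) * r / u 1) by (field; lra).
    unfold Rdiv; apply Rmult_le_compat_r; [left; now apply Rinv_0_lt_compat|]. nra.
Qed.

(* Pohozaev's identity for the critical exponent, divided by the flux times [u]. *)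
Lemma pohozaev (n k : nat) (K M : R) (u v : R -> R) :
  let p := p_so n k in
  profile_at_0 n k p K M u v -> (0 < k)%nat -> (2 * k < n)%nat -> 0 < K ->
  forall r, 0 < r ->
    INR k * emden_X u v r + (INR n - 2 * INR k) / INR n * emden_Y k p K u v r
    = INR n - 2 * INR k.
Proof.
  intros p H0 Hk Hn HK.
  pose proof (INR_dimension_gap n k Hn) as HN. assert (Hk0 : 0 < INR k) by now apply lt_0_INR.
  assert (Hp : 0 < p).
  { apply Rdiv_lt_0_compat; [apply Rmult_lt_0_compat|]; lra. }
  pose proof H0 as [H Hb Hz].
  set (X := emden_X u v); set (Y := emden_Y k p K u v).
  set (z := fun r => r ^ (n - k) * v r ^ k) in *.
  set (I := fun r => INR k * X r + (INR n - 2 * INR k) / INR n * Y r - (INR n - 2 * INR k)).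
  set (dI := fun r => INR k * (X r * ((X r + Y r / INR k - (INR n - 2 * INR k) / INR k) / r))
     + (INR n - 2 * INR k) / INR n * (Y r * ((INR n - p * X r - Y r) / r)) - 0).
  assert (HI : forall r, 0 < r -> derivable_pt_lim (fun s => z s * u s * I s) r 0).
  { intros r Hr.
    apply (derivable_pt_lim_value _ _ (z r * u r * (Y r / r + - X r / r) * I r + z r * u r * dI r)).
    - apply (derivable_pt_lim_mult (fun s => z s * u s) I).
      + apply (log_derivative_mult z u); [apply flux_log_derivative; auto; lia|].
        now apply (profile_u_log n k p K).
      + apply (derivable_pt_lim_minus
          (fun r => INR k * X r + (INR n - 2 * INR k) / INR n * Y r)
          (fun _ => INR n - 2 * INR k)); [|apply derivable_pt_lim_const].
        apply (derivable_pt_lim_plus (fun r => INR k * X r)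
          (fun r => (INR n - 2 * INR k) / INR n * Y r)).
        * apply (derivable_pt_lim_scal X); now apply emden_X_derive.
        * apply (derivable_pt_lim_scal Y); now apply (emden_Y_derive n k p K u v).
    (* In [r / (z u)] times the derivative every term cancels but [X Y], whose coefficient
       [1 + k - (n - 2k) (p + 1) / n] vanishes precisely at [p_so]. *)
    - unfold I, dI, p, p_so; field; lra. }
  assert (Hv : vanishes_at_0 (fun s => z s * u s * I s)).
  { destruct (emden_X_vanishes n k p K M u v H0 Hk ltac:(lia) HK Hp 1 Rlt_0_1) as (d & Hd & HX).
    apply (vanishes_dominated _ z (M * (INR k + 2 * (INR n - 2 * INR k))) d); [exact Hd| |exact Hz].
    intros r Hr; specialize (HX r Hr); fold X in HX; apply Rabs_def2 in HX.
    pose proof (emden_X_pos n k p K u v r H ltac:(lra)) as X0; fold X in X0.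
    pose proof (emden_Y_pos n k p K u v r H HK ltac:(lra)) as Y0; fold Y in Y0.
    pose proof (emden_Y_le_dimension n k p K M u v r H0 Hk ltac:(lia) HK Hp ltac:(lra)) as Yn.
    fold Y in Yn.
    pose proof (profile_u_pos _ _ _ _ _ _ H r ltac:(lra)) as U0. specialize (Hb r ltac:(lra)).
    rewrite !Rabs_mult, (Rabs_pos_eq (u r)) by lra.
    assert (HIr : Rabs (I r) <= INR k + 2 * (INR n - 2 * INR k)).
    { assert (HY : 0 <= (INR n - 2 * INR k) / INR n * Y r <= INR n - 2 * INR k).
      { split; [apply Rmult_le_pos; [apply Rdiv_le_0_compat|]; lra|].
        apply Rle_trans with ((INR n - 2 * INR k) / INR n * INR n); [|right; field; lra].
        apply Rmult_le_compat_l; [apply Rdiv_le_0_compat|]; lra. }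
      assert (0 <= INR k * X r <= INR k) by nra.
      apply Rabs_le; unfold I; lra. }
    rewrite Rmult_assoc, (Rmult_comm (Rabs (z r))).
    apply Rmult_le_compat_r; [apply Rabs_pos|].
    apply Rmult_le_compat; try lra; apply Rabs_pos. }
  intros r Hr.
  (* Zero derivative and limit 0 at the origin make [z u I] both nonnegative and nonpositive. *)
  assert (H1 : 0 <= z r * u r * I r)
    by (apply (nonneg_of_vanishing_increasing (fun s => z s * u s * I s) (fun _ => 0)); auto; intros; lra).
  assert (H2 : 0 <= - (z r * u r * I r)).
  { apply (nonneg_of_vanishing_increasing (fun s => - (z s * u s * I s)) (fun _ => 0)); auto.
    - intros x Hx; apply (derivable_pt_lim_value _ _ (- 0)); [|ring].
      apply (derivable_pt_lim_opp (fun s => z s * u s * I s)); auto.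
    - intros; lra.
    - intros eps He; destruct (Hv eps He) as (d & Hd & Hd'); exists d; split; [exact Hd|].
      intros x Hx; rewrite Rabs_Ropp; auto. }
  assert (Hzu : 0 < z r * u r).
  { apply Rmult_lt_0_compat; [|now apply (profile_u_pos _ _ _ _ _ _ H)].
    apply Rmult_lt_0_compat; apply pow_lt; [exact Hr|now apply (profile_v_pos _ _ _ _ _ _ H)]. }
  assert (HI0 : I r = 0).
  { apply Rmult_eq_reg_l with (z r * u r); lra. }
  unfold I in HI0; lra.
Qed.

(** On the Pohozaev line the system reads [r X' = 2 X Y / n], [r Y' = - 2k / (n - 2k) X Y]. So [X]
    increases, and from [r = 1] on [r Y' / Y <= - s] with [s = 2k X(1) / (n - 2k)]: [Y] decays like
    a power. *)
Lemma critical_emden_Y_small (n k : nat) (K M eps : R) (u v : R -> R) :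
  let p := p_so n k in
  profile_at_0 n k p K M u v -> (0 < k)%nat -> (2 * k < n)%nat -> 0 < K -> 0 < eps ->
  exists M2, 0 < M2 /\ forall r, M2 < r -> emden_Y k p K u v r <= eps.
Proof.
  intros p H0 Hk Hn HK He.
  pose proof (INR_dimension_gap n k Hn) as HN. assert (Hk0 : 0 < INR k) by now apply lt_0_INR.
  pose proof (pohozaev n k K M u v H0 Hk Hn HK) as HI. fold p in HI.
  destruct H0 as [H _ _].
  set (X := emden_X u v) in *; set (Y := emden_Y k p K u v) in *.
  assert (HX0 : forall r, 0 < r -> 0 < X r) by (intros r Hr; now apply (emden_X_pos n k p K)).
  assert (HY0 : forall r, 0 < r -> 0 < Y r) by (intros r Hr; now apply (emden_Y_pos n k p K)).
  assert (EY : forall r, 0 < r -> Y r = INR n - INR n * INR k / (INR n - 2 * INR k) * X r).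
  { intros r Hr; specialize (HI r Hr).
    replace (Y r) with (INR n / (INR n - 2 * INR k) * ((INR n - 2 * INR k) / INR n * Y r))
      by (field; lra).
    replace ((INR n - 2 * INR k) / INR n * Y r) with (INR n - 2 * INR k - INR k * X r) by lra.
    field; lra. }
  assert (Hinc : forall r, 1 <= r -> X 1 <= X r).
  { intros r Hr; apply (nonneg_derivative_le X
      (fun r => X r * ((X r + Y r / INR k - (INR n - 2 * INR k) / INR k) / r))); [lra| |].
    - intros x Hx; apply (emden_X_derive n k p K); auto; lra.
    - intros x Hx; specialize (HX0 x ltac:(lra)); specialize (HY0 x ltac:(lra)).
      specialize (HI x ltac:(lra)).
      replace (X x + Y x / INR k - (INR n - 2 * INR k) / INR k)
        with ((INR k * X x + (INR n - 2 * INR k) / INR n * Y x - (INR n - 2 * INR k)) / INR k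
              + 2 * Y x / INR n) by (field; lra).
      replace (INR k * X x + _ - _) with 0 by lra.
      apply Rmult_le_pos; [lra|]; apply Rdiv_le_0_compat; [|lra].
      assert (0 < 2 * Y x / INR n) by (apply Rdiv_lt_0_compat; lra). lra. }
  set (s := 2 * INR k / (INR n - 2 * INR k) * X 1).
  assert (Hs : 0 < s).
  { apply Rmult_lt_0_compat; [apply Rdiv_lt_0_compat; lra|apply HX0; lra]. }
  assert (HY1 : 0 < Y 1) by (apply HY0; lra).
  destruct (Rpower_small_at_infinity s (eps / Y 1) Hs) as (M2 & HM2 & Hsm);
    [now apply Rdiv_lt_0_compat|].
  exists (Rmax 1 M2); pose proof (Rmax_l 1 M2); pose proof (Rmax_r 1 M2).
  split; [lra|]; intros r Hr; specialize (Hsm r ltac:(lra)).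
  assert (Hdec : Y r * Rpower r s <= Y 1 * Rpower 1 s).
  { apply (power_decay Y (fun r => INR n - p * X r - Y r)); try lra.
    - intros x Hx; apply HY0; lra.
    - intros x Hx; apply (emden_Y_derive n k p K u v); auto; lra.
    - intros x Hx; rewrite EY by lra; specialize (Hinc x Hx).
      replace (INR n - p * X x - _) with (- (2 * INR k / (INR n - 2 * INR k) * X x))
        by (unfold p, p_so; field; lra).
      apply Ropp_le_contravar; unfold s; apply Rmult_le_compat_l; [|exact Hinc].
      apply Rdiv_le_0_compat; lra. }
  replace (Rpower 1 s) with 1 in Hdec by (unfold Rpower; rewrite ln_1, Rmult_0_r; now rewrite exp_0).
  replace (Y r) with (Y r * Rpower r s * Rpower r (- s)).
  2:{ rewrite Rmult_assoc, <- Rpower_plus, Rplus_opp_r, Rpower_O by lra; ring. }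
  pose proof (Rpower_pos r (- s)).
  apply Rle_trans with (Y 1 * 1 * Rpower r (- s)); [apply Rmult_le_compat_r; lra|].
  apply (Rmult_lt_compat_l _ _ _ HY1) in Hsm.
  replace (Y 1 * (eps / Y 1)) with eps in Hsm by (field; lra). lra.
Qed.

(* The region [X < Xs], [Y - Ys < mu (Xs - X)] is invariant, where the slope
   [mu = k (Xs + Ys) / (2 Xs)] lies between the slopes of the eigendirections of the node [(Xs, Ys)];
   it contains the orbit near its initial point [(0, n)]. *)
Lemma emden_X_lt_singular (n k : nat) (p K Xs Ys : R) (u v : R -> R) :
  profile n k p K u v -> (0 < k)%nat -> 0 < K -> INR k < p -> 0 < Xs <= Ys ->
  Xs + Ys / INR k = (INR n - 2 * INR k) / INR k -> INR n = p * Xs + Ys ->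
  4 * p * (Xs * Ys) <= INR k * (Xs + Ys) ^ 2 ->
  (forall r, 0 < r -> emden_Y k p K u v r <= INR n) -> vanishes_at_0 (emden_X u v) ->
  forall r, 0 < r -> emden_X u v r < Xs.
Proof.
  intros H Hk HK Hkp Hs Heq Hn Hjl HYn HX0 r1 Hr1.
  assert (Hk0 : 0 < INR k) by now apply lt_0_INR.
  set (X := emden_X u v) in *; set (Y := emden_Y k p K u v) in *.
  assert (HXp : forall r, 0 < r -> 0 < X r) by (intros r Hr; now apply (emden_X_pos n k p K)).
  assert (HYp : forall r, 0 < r -> 0 < Y r) by (intros r Hr; now apply (emden_Y_pos n k p K)).
  set (mu := INR k * (Xs + Ys) / (2 * Xs)).
  (* If [mu <= p], the discriminant condition yields [Ys <= Xs], hence equality, and then reads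
     [p <= k]. The strict inequality puts [(0, n)] inside the region, as [n - Ys = p Xs]. *)
  assert (Hmu : p < mu).
  { destruct (Rlt_le_dec p mu) as [|Hle]; [assumption|exfalso].
    apply (Rmult_le_compat_r (2 * Xs)) in Hle; [|lra].
    replace (mu * (2 * Xs)) with (INR k * (Xs + Ys)) in Hle by (unfold mu; field; lra).
    assert (HS : 0 < INR k * (Xs + Ys)) by (apply Rmult_lt_0_compat; lra).
    assert (Hle2 : 2 * Ys * (INR k * (Xs + Ys)) <= 2 * Ys * (p * (2 * Xs)))
      by (apply Rmult_le_compat_l; lra).
    assert (Heq' : Ys = Xs).
    { apply Rle_antisym; [|lra].
      apply Rmult_le_reg_l with (INR k * (Xs + Ys)); [exact HS|]. lra. }
    rewrite Heq' in Hjl.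
    assert (0 < Xs * Xs * (p - INR k)) by (repeat apply Rmult_lt_0_compat; lra). lra. }
  (* [- B0 k / Xs] is the value at its vertex [m = mu] of [m^2 - k (1 + Ys / Xs) m + k p Ys / Xs],
     whose roots are the negatives of the eigenslopes; [B0 >= 0] says that they are real. *)
  set (B0 := Ys * (mu - p) - mu * Xs * (mu - INR k) / INR k).
  assert (HB0 : 0 <= B0).
  { replace B0 with ((INR k * (Xs + Ys) ^ 2 - 4 * p * (Xs * Ys)) / (4 * Xs))
      by (unfold B0, mu; field; lra).
    apply Rdiv_le_0_compat; lra. }
  set (a := fun r => Xs - X r). set (e := fun r => mu * (Xs - X r) - (Y r - Ys)).
  set (dX := fun r => X r * ((X r + Y r / INR k - (INR n - 2 * INR k) / INR k) / r)).
  set (dY := fun r => Y r * ((INR n - p * X r - Y r) / r)).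
  assert (Ha : forall r, 0 < r -> derivable_pt_lim a r (0 - dX r)).
  { intros r Hr; apply (derivable_pt_lim_minus (fun _ => Xs) X);
      [apply derivable_pt_lim_const|now apply emden_X_derive]. }
  assert (He : forall r, 0 < r -> derivable_pt_lim e r (mu * (0 - dX r) - (dY r - 0))).
  { intros r Hr; apply (derivable_pt_lim_minus (fun r => mu * (Xs - X r)) (fun r => Y r - Ys)).
    - now apply (derivable_pt_lim_scal a), Ha.
    - apply (derivable_pt_lim_minus Y (fun _ => Ys)); [|apply derivable_pt_lim_const].
      now apply (emden_Y_derive n k p K u v). }
  destruct (Rlt_le_dec (X r1) Xs) as [|Hge]; [assumption|exfalso].
  (* Below this bound on [X], [Y <= n] and [n - Ys = p Xs] give [e > 0]. *)
  destruct (HX0 ((mu - p) * Xs / mu)) as (d & Hd & Hsmall).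
  { apply Rdiv_lt_0_compat; [apply Rmult_lt_0_compat|]; lra. }
  set (r0 := Rmin d r1 / 2).
  pose proof (Rmin_pos d r1 Hd Hr1); pose proof (Rmin_l d r1); pose proof (Rmin_r d r1).
  assert (Hr0 : 0 < r0 < r1 /\ r0 < d) by (unfold r0; lra).
  specialize (Hsmall r0 ltac:(lra)); apply Rabs_def2 in Hsmall; destruct Hsmall as [Hsm _].
  apply (Rmult_lt_compat_l mu) in Hsm; [|lra].
  replace (mu * ((mu - p) * Xs / mu)) with ((mu - p) * Xs) in Hsm by (field; lra).
  assert (He0 : 0 < e r0).
  { specialize (HYn r0 ltac:(lra)); unfold e; lra. }
  assert (Ha0 : 0 < a r0) by (unfold a; nra).
  assert (HXc : forall r, 0 < r -> continuity_pt X r)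
    by (intros r Hr; now apply (emden_X_continuity n k p K u v)).
  assert (HYc : forall r, 0 < r -> continuity_pt Y r)
    by (intros r Hr; now apply (emden_Y_continuity n k p K u v)).
  assert (Hcst : forall c r, continuity_pt (fun _ => c) r)
    by (intros c r; apply continuity_pt_const; now intros ? ?).
  destruct (first_nonpositive a r0 r1) as (c & Hc & Hac & Hpos); [lra| |exact Ha0|unfold a; lra|].
  { intros x Hx; exact (derivable_pt_lim_continuity _ _ _ (Ha x ltac:(lra))). }
  (* Only [a c <= 0] is known at the contact point; continuity from the left excludes [a c < 0], so
     [a >= 0] on the closed interval, as the estimate for [e] requires. *)
  assert (Hannoneg : forall r, r0 <= r <= c -> 0 <= a r).
  { intros r Hr; destruct (Req_dec r c) as [->|]; [|left; apply Hpos; lra].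
    destruct (Rle_lt_dec 0 (a c)) as [|Hneg]; [assumption|exfalso].
    destruct (derivable_pt_lim_continuity _ _ _ (Ha c ltac:(lra)) (- a c) ltac:(lra)) as (t & Ht & Hb).
    set (x := c - Rmin (t / 2) (c - r0)).
    assert (Hm : 0 < Rmin (t / 2) (c - r0)) by (apply Rmin_pos; lra).
    pose proof (Rmin_l (t / 2) (c - r0)); pose proof (Rmin_r (t / 2) (c - r0)).
    specialize (Hpos x ltac:(unfold x; lra)).
    specialize (Hb x); simpl in Hb; unfold R_dist in Hb.
    assert (Hb' : Rabs (a x - a c) < - a c).
    { apply Hb; unfold x; split; [split; [exact I|lra]|apply Rabs_def1; lra]. }
    apply Rabs_def2 in Hb'; lra. }
  assert (Hepos : forall r, r0 <= r <= c -> 0 < e r).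
  { intros r Hr.
    apply (gronwall_pos e (fun r => mu * (0 - dX r) - (dY r - 0))
      (fun r => (mu / INR k * X r - Y r - (mu - p) * (Xs - X r)) / r) r0 r); [lra| | | |exact He0].
    - intros x Hx; apply He; lra.
    - intros x Hx; apply continuity_pt_over_id; [lra|].
      specialize (HXc x ltac:(lra)); specialize (HYc x ltac:(lra)).
      apply (continuity_pt_minus (fun x => mu / INR k * X x - Y x) (fun x => (mu - p) * (Xs - X x))).
      + apply (continuity_pt_minus (fun x => mu / INR k * X x) Y); [|exact HYc].
        apply (continuity_pt_mult (fun _ => mu / INR k) X); auto.
      + apply (continuity_pt_mult (fun _ => mu - p) (fun x => Xs - X x)); auto.
        apply (continuity_pt_minus (fun _ => Xs) X); auto.
    - intros x Hx; specialize (Hannoneg x ltac:(lra)).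
      assert (0 <= a x * (B0 + a x * (mu * (mu - p) + mu * (mu - INR k) / INR k)) / x).
      { apply Rdiv_le_0_compat; [|lra]. apply Rmult_le_pos; [exact Hannoneg|].
        apply Rplus_le_le_0_compat; [exact HB0|]. apply Rmult_le_pos; [exact Hannoneg|].
        apply Rplus_le_le_0_compat; [|apply Rdiv_le_0_compat; [|exact Hk0]]; apply Rmult_le_pos; lra. }
      (* Splitting off a multiple of [e] leaves [a / x] times the sum of [B0] and a nonnegative
         multiple of [a], since [mu > p > k]. *)
      replace (mu * (0 - dX x) - (dY x - 0))
        with ((mu / INR k * X x - Y x - (mu - p) * (Xs - X x)) / x * e x
          + a x * (B0 + a x * (mu * (mu - p) + mu * (mu - INR k) / INR k)) / x).
      + lra.
      + unfold dX, dY; rewrite <- Heq, Hn; unfold a, e, B0; field; lra. }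
  (* With [e > 0], [a] in turn satisfies a linear differential inequality and cannot reach 0 at
     [c]. *)
  enough (0 < a c) by lra.
  apply (gronwall_pos a (fun r => 0 - dX r) (fun r => (1 - mu / INR k) * X r / r) r0 c);
    [lra| | | |exact Ha0].
  - intros x Hx; apply Ha; lra.
  - intros x Hx; apply continuity_pt_over_id; [lra|].
    apply (continuity_pt_mult (fun _ => 1 - mu / INR k) X); auto; apply HXc; lra.
  - intros x Hx; specialize (Hepos x Hx); specialize (HXp x ltac:(lra)).
    assert (0 < X x * e x / (INR k * x))
      by (apply Rdiv_lt_0_compat; apply Rmult_lt_0_compat; lra).
    replace (0 - dX x) with ((1 - mu / INR k) * X x / x * a x + X x * e x / (INR k * x));
      [lra|].
    unfold dX; rewrite <- Heq; unfold a, e; field; lra.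
Qed.

(* The linearized equation has the positive solution [u (Xs - X)], generated by the scaling
   [u(r) -> t^Xs u(t r)]; [G] is minus its logarithmic derivative times [r]. *)
Lemma stable_on_of_X_lt_singular (n k : nat) (p Xs Ys : R) (u v : R -> R) :
  (0 < k)%nat -> (2 * k < n)%nat -> sol11 n k p u ->
  vanishes_at_0 (fun r => u r * Rpower r ((INR n - 2 * INR k) / INR k)) ->
  profile n k p (INR k / Cnk n k) u v ->
  Xs + Ys / INR k = (INR n - 2 * INR k) / INR k -> INR n = p * Xs + Ys ->
  (forall r, 0 < r -> emden_X u v r < Xs) ->
  stable_on n k p u 1.
Proof.
  intros Hk Hkn Hsol Hvan H Heq Hn HX.
  assert (Hk0 : 0 < INR k) by now apply lt_0_INR.
  set (K := INR k / Cnk n k) in *.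
  set (X := emden_X u v) in *; set (Y := emden_Y k p K u v).
  set (dX := fun r => X r * ((X r + Y r / INR k - (INR n - 2 * INR k) / INR k) / r)).
  set (dY := fun r => Y r * ((INR n - p * X r - Y r) / r)).
  assert (HdX : forall r, 0 < r -> derivable_pt_lim X r (dX r))
    by (intros r Hr; now apply emden_X_derive).
  assert (HdY : forall r, 0 < r -> derivable_pt_lim Y r (dY r))
    by (intros r Hr; now apply (emden_Y_derive n k p K u v)).
  (* This is [G = X + r X' / (Xs - X)], simplified by [X + Y / k - (n - 2k) / k = (X - Xs) + (Y -
     Ys) / k]. *)
  apply (stable_on_of_riccati n k p 1 u v
    (fun r => X r * (Y r - Ys) * / (INR k * (Xs - X r)))
    (fun r => (dX r * (Y r - Ys) + X r * (dY r - 0)) * / (INR k * (Xs - X r))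
       + X r * (Y r - Ys) * (- (INR k * (0 - dX r)) / (INR k * (Xs - X r)) ^ 2))); auto; [lra| |].
  - intros r Hr; specialize (HX r ltac:(lra)).
    apply (derivable_pt_lim_mult (fun r => X r * (Y r - Ys)) (fun r => / (INR k * (Xs - X r)))).
    + apply (derivable_pt_lim_mult X (fun r => Y r - Ys)); [apply HdX; lra|].
      apply (derivable_pt_lim_minus Y (fun _ => Ys)); [apply HdY; lra|apply derivable_pt_lim_const].
    + apply is_derive_Reals, (is_derive_inv (fun r => INR k * (Xs - X r))).
      * apply is_derive_Reals, (derivable_pt_lim_scal (fun r => Xs - X r)).
        apply (derivable_pt_lim_minus (fun _ => Xs) X); [apply derivable_pt_lim_const|apply HdX; lra].
      * apply Rmult_integral_contrapositive; lra.
  - intros r Hr; specialize (HX r ltac:(lra)); cbv zeta; fold K; fold X; fold Y.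
    (* The Riccati inequality is an equality here, the linearized equation being solved exactly. *)
    right; unfold dX, dY; rewrite <- Heq, Hn; field; lra.
Qed.

(** * The Joseph-Lundgren exponent and the three cases *)

(** The difference of the two sides is a quadratic in [p] with leading coefficient [L], and [p_jl]
    is its larger root: multiplied by [L] it becomes [y^2 - 16 k^2 D], and [p >= p_jl] says
    [y >= 4 k sqrt D]. *)
Lemma p_jl_node (N k p : R) :
  0 < k -> 2 * k + 8 < N ->
  (k * (N ^ 2 - 2 * (k + 3) * N + 4 * k) + 4 * k * sqrt (2 * (k + 1) * N - 4 * k))
    / ((N - 2 * k) * (N - 2 * k - 8)) <= p ->
  8 * p * ((N - 2 * k) * p - N * k) <= ((N - 2 * k) * p - k * (N - 2)) ^ 2.
Proof.
  intros Hk HN Hp; set (D := 2 * (k + 1) * N - 4 * k) in *.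
  set (L := (N - 2 * k) * (N - 2 * k - 8)) in *.
  assert (HL : 0 < L) by (apply Rmult_lt_0_compat; lra).
  assert (HD : 0 <= D) by (unfold D; nra).
  apply (Rmult_le_compat_r L) in Hp; [|lra].
  replace (_ / L * L) with (k * (N ^ 2 - 2 * (k + 3) * N + 4 * k) + 4 * k * sqrt D) in Hp
    by (field; lra).
  set (y := p * L - k * (N ^ 2 - 2 * (k + 3) * N + 4 * k)).
  assert (Hy : (4 * k * sqrt D) ^ 2 <= y ^ 2).
  { apply pow_incr; split; [|unfold y; lra].
    apply Rmult_le_pos; [lra|apply sqrt_pos]. }
  replace ((4 * k * sqrt D) ^ 2) with (16 * k ^ 2 * (sqrt D * sqrt D)) in Hy by ring.
  rewrite sqrt_sqrt in Hy by exact HD.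
  apply Rmult_le_reg_l with L; [exact HL|].
  enough (E : L * ((N - 2 * k) * p - k * (N - 2)) ^ 2 - L * (8 * p * ((N - 2 * k) * p - N * k))
    = y ^ 2 - 16 * k ^ 2 * D) by lra.
  unfold y, L, D; ring.
Qed.

Lemma vanishing_of_bounded (u : R -> R) (beta C d : R) :
  0 < beta -> 0 < d -> (forall r, 0 < r < d -> 0 < u r <= C) ->
  vanishes_at_0 (fun r => u r * Rpower r beta).
Proof.
  intros Hb Hd Hu; apply (vanishes_dominated _ (fun r => Rpower r beta) C d); [exact Hd| |].
  - intros r Hr; specialize (Hu r Hr). rewrite Rabs_mult, (Rabs_pos_eq (u r)) by lra.
    apply Rmult_le_compat_r; [apply Rabs_pos|lra].
  - intros eps He; destruct (Rpower_small beta eps Hb He) as (t & Ht & H).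
    exists t; split; [exact Ht|]; intros r Hr.
    rewrite Rabs_pos_eq; [now apply H|left; apply Rpower_pos].
Qed.

Lemma regular_bounded_near_0 (n k : nat) (p rho : R) (u : R -> R) :
  regular_sol16 n k p rho u ->
  exists C d, 0 < d /\ forall r, 0 < r < d -> 0 < u r <= C.
Proof.
  intros ([Hu _] & _ & Hd & _).
  destruct (Hd 1 Rlt_0_1) as (d & Hdp & H).
  exists (u 0 + d), d; split; [exact Hdp|]; intros r Hr; split; [apply Hu; lra|].
  specialize (H r Hr); apply Rabs_def2 in H; destruct H as [H _].
  apply (Rmult_lt_compat_r r) in H; [|lra].
  replace ((u r - u 0) / r * r) with (u r - u 0) in H by (field; lra). lra.
Qed.

(** The bound on [u] near 0 comes from [u'(0) = 0]; it becomes global once [u] is known to be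
    decreasing. *)
Lemma regular_profile_at_0 (n k : nat) (p rho : R) (u : R -> R) :
  (0 < k)%nat -> (2 * k < n)%nat -> regular_sol16 n k p rho u ->
  vanishes_at_0 (fun r => u r * Rpower r ((INR n - 2 * INR k) / INR k)) /\
  exists M v, profile_at_0 n k p (INR k / Cnk n k) M u v.
Proof.
  intros Hk Hn Hreg; destruct (regular_bounded_near_0 _ _ _ _ _ Hreg) as (C & d & Hd & Hu).
  pose proof (INR_dimension_gap n k Hn) as HN. assert (Hk0 : 0 < INR k) by now apply lt_0_INR.
  assert (Hv : vanishes_at_0 (fun r => u r * Rpower r ((INR n - 2 * INR k) / INR k))).
  { apply (vanishing_of_bounded u _ C d); auto; apply Rdiv_lt_0_compat; lra. }
  split; [exact Hv|].
  destruct (profile_of_sol11 n k p u Hk Hn ltac:(apply Hreg) Hv) as (v & Hp & Hz).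
  exists C, v; constructor; [exact Hp| |exact Hz].
  intros r Hr; pose proof (Rmin_pos r d Hr Hd); pose proof (Rmin_l r d); pose proof (Rmin_r r d).
  apply Rle_trans with (u (Rmin r d / 2)); [|apply Hu; lra].
  apply (profile_u_decreasing n k p _ u v _ _ Hp); lra.
Qed.

(** Pohozaev's identity serves twice: with [Y > 0] it keeps [X] below [(n - 2k) / k], and it makes
    [Y] decay. *)
Lemma stable_on_critical (n k : nat) (rho : R) (u : R -> R) :
  (0 < k)%nat -> (2 * k < n)%nat -> regular_sol16 n k (p_so n k) rho u ->
  exists R0, 0 < R0 /\ stable_on n k (p_so n k) u R0.
Proof.
  intros Hk Hn Hreg; set (p := p_so n k) in *.
  pose proof (INR_dimension_gap n k Hn) as HN. assert (Hk0 : 0 < INR k) by now apply lt_0_INR.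
  assert (HK : 0 < INR k / Cnk n k) by (apply Rdiv_lt_0_compat; [lra|apply Cnk_pos]).
  assert (Hp : 0 < p) by (apply Rdiv_lt_0_compat; [apply Rmult_lt_0_compat|]; lra).
  destruct (regular_profile_at_0 n k p rho u Hk Hn Hreg) as (Hv & M & v & H0).
  destruct (critical_emden_Y_small n k _ M ((INR n - 2 * INR k) / (4 * p)) u v H0 Hk Hn HK)
    as (M2 & HM2 & HY); [apply Rdiv_lt_0_compat; lra|].
  exists (M2 + 1); split; [lra|].
  apply (stable_on_of_small_Y n k p _ u v); auto; [lra|apply Hreg|apply H0| |].
  - intros r Hr; pose proof (pohozaev n k _ M u v H0 Hk Hn HK r ltac:(lra)) as HI.
    fold p in HI.
    pose proof (emden_Y_pos n k p _ u v r (profile_at_0_profile _ _ _ _ _ _ _ H0) HK ltac:(lra)) as Y0.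
    apply Rmult_le_reg_l with (INR k); [exact Hk0|].
    replace (INR k * ((INR n - 2 * INR k) / INR k)) with (INR n - 2 * INR k) by (field; lra).
    assert (0 < (INR n - 2 * INR k) / INR n) by (apply Rdiv_lt_0_compat; lra).
    nra.
  - intros r Hr; apply HY; lra.
Qed.

Lemma p_so_gt (n k : nat) : (0 < k)%nat -> (2 * k < n)%nat -> INR k < p_so n k.
Proof.
  intros Hk Hn; pose proof (INR_dimension_gap n k Hn) as HN.
  assert (Hk0 : 0 < INR k) by now apply lt_0_INR.
  unfold p_so; apply Rmult_lt_reg_r with (INR n - 2 * INR k); [lra|].
  replace (_ / _ * _) with ((INR n + 2) * INR k) by (field; lra). nra.
Qed.

Lemma p_so_le_p_star (n k : nat) : (0 < k)%nat -> (2 * k < n)%nat -> p_so n k <= p_star n k.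
Proof.
  intros Hk Hn; pose proof (INR_dimension_gap n k Hn) as HN.
  assert (Hk0 : 1 <= INR k) by (apply (le_INR 1); lia).
  unfold p_so, p_star, Rdiv; apply Rmult_le_compat_r; [left; apply Rinv_0_lt_compat; lra|]. nra.
Qed.

Lemma stable_on_joseph_lundgren (n k : nat) (p rho : R) (u : R -> R) :
  (0 < k)%nat -> (2 * k < n)%nat -> p_so n k <= p -> ge_p_jl n k p ->
  regular_sol16 n k p rho u -> stable_on n k p u 1.
Proof.
  intros Hk Hn Hso [Hn8 Hjl] Hreg.
  pose proof (INR_dimension_gap n k Hn) as HN. assert (Hk0 : 0 < INR k) by now apply lt_0_INR.
  assert (HK : 0 < INR k / Cnk n k) by (apply Rdiv_lt_0_compat; [lra|apply Cnk_pos]).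
  pose proof (p_so_gt n k Hk Hn) as Hkso.
  assert (HN8 : 2 * INR k + 8 < INR n).
  { apply lt_INR in Hn8; rewrite plus_INR, mult_INR in Hn8; simpl in Hn8; lra. }
  pose proof (p_jl_node _ _ _ Hk0 HN8 Hjl) as Hnode.
  destruct (regular_profile_at_0 n k p rho u Hk Hn Hreg) as (Hv & M & v & H0).
  (* [Xs] is the decay exponent of [u_s], hence the constant value of [X] on it; [Ys] is then fixed
     by [r Y' = 0]. *)
  set (Xs := 2 * INR k / (p - INR k)). set (Ys := INR n - p * Xs).
  assert (Heq : Xs + Ys / INR k = (INR n - 2 * INR k) / INR k)
    by (unfold Ys, Xs; field; lra).
  assert (HXs : 0 < Xs) by (apply Rdiv_lt_0_compat; lra).
  (* After multiplication by [p - k] this is [2k <= (n - 2k) p - n k], that is, [p >= p_so]. *)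
  assert (HXY : Xs <= Ys).
  { apply Rmult_le_reg_r with (p - INR k); [lra|].
    replace (Ys * (p - INR k)) with ((INR n - 2 * INR k) * p - INR n * INR k)
      by (unfold Ys, Xs; field; lra).
    replace (Xs * (p - INR k)) with (2 * INR k) by (unfold Xs; field; lra).
    apply (Rmult_le_compat_l (INR n - 2 * INR k)) in Hso; [|lra].
    replace ((INR n - 2 * INR k) * p_so n k) with ((INR n + 2) * INR k) in Hso
      by (unfold p_so; field; lra). lra. }
  (* Multiplied by [(p - k)^2 / k], the discriminant condition of the node is the quadratic
     inequality of [p_jl_node]. *)
  assert (Hdisc : 4 * p * (Xs * Ys) <= INR k * (Xs + Ys) ^ 2).
  { replace (4 * p * (Xs * Ys))
      with (INR k / (p - INR k) ^ 2 * (8 * p * ((INR n - 2 * INR k) * p - INR n * INR k)))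
      by (unfold Ys, Xs; field; lra).
    replace (INR k * (Xs + Ys) ^ 2)
      with (INR k / (p - INR k) ^ 2 * ((INR n - 2 * INR k) * p - INR k * (INR n - 2)) ^ 2)
      by (unfold Ys, Xs; field; lra).
    apply Rmult_le_compat_l; [|exact Hnode].
    apply Rdiv_le_0_compat; [lra|apply pow_lt; lra]. }
  assert (HYs : INR n = p * Xs + Ys) by (unfold Ys; ring).
  apply (stable_on_of_X_lt_singular n k p Xs Ys u v); auto; [apply Hreg|apply H0|].
  apply (emden_X_lt_singular n k p (INR k / Cnk n k) Xs Ys u v); auto; [apply H0|lra| |].
  - intros r Hr; apply (emden_Y_le_dimension n k p _ M); auto; [lia|lra].
  - apply (emden_X_vanishes n k p _ M u v H0 Hk); [lia|exact HK|lra].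
Qed.

(** Near 0, [u] is at most twice [u_s], of order [r^(- alpha)] with [alpha = 2k / (p - k)], and
    [p > p_se] gives [alpha < (n - 2k) / k]. *)
Lemma singular_vanishing (n k : nat) (p : R) (u : R -> R) :
  (0 < k)%nat -> (2 * k < n)%nat -> p_se n k < p -> (forall r, 0 < r -> 0 < u r) ->
  (forall eps, 0 < eps -> exists d, 0 < d /\
     forall r, 0 < r < d -> Rabs (u r / u_s n k p r - 1) < eps) ->
  vanishes_at_0 (fun r => u r * Rpower r ((INR n - 2 * INR k) / INR k)).
Proof.
  intros Hk Hn Hse Hu Hlim.
  pose proof (INR_dimension_gap n k Hn) as HN. assert (Hk0 : 0 < INR k) by now apply lt_0_INR.
  apply (Rmult_lt_compat_l (INR n - 2 * INR k)) in Hse; [|lra].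
  replace ((INR n - 2 * INR k) * p_se n k) with (INR n * INR k) in Hse
    by (unfold p_se; field; lra).
  assert (Hkp : INR k < p) by nra.
  set (beta := (INR n - 2 * INR k) / INR k). set (alpha := 2 * INR k / (p - INR k)).
  assert (Hab : 0 < beta - alpha).
  { replace (beta - alpha) with (((INR n - 2 * INR k) * p - INR n * INR k) / (INR k * (p - INR k)))
      by (unfold beta, alpha; field; lra).
    apply Rdiv_lt_0_compat; [lra|apply Rmult_lt_0_compat; lra]. }
  assert (HA : 0 < A_s n k p).
  { apply Rmult_lt_0_compat; [apply Rmult_lt_0_compat|]; apply Rpower_pos. }
  destruct (Hlim 1 Rlt_0_1) as (d & Hd & H).
  apply (vanishes_dominated _ (fun r => 1 * Rpower r (beta - alpha)) (2 * A_s n k p) d); [exact Hd| |].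
  - intros r Hr; specialize (H r Hr); apply Rabs_def2 in H; destruct H as [H _].
    specialize (Hu r ltac:(lra)).
    pose proof (Rpower_pos r (- alpha)); pose proof (Rpower_pos r beta).
    pose proof (Rpower_pos r (beta - alpha)).
    assert (Hus : 0 < u_s n k p r) by (now apply Rmult_lt_0_compat).
    assert (Hle : u r <= 2 * u_s n k p r).
    { apply Rmult_le_reg_r with (/ u_s n k p r); [now apply Rinv_0_lt_compat|].
      rewrite Rmult_assoc, Rinv_r by lra. unfold Rdiv in H; lra. }
    rewrite !Rabs_pos_eq by (apply Rmult_le_pos; lra).
    replace (beta - alpha) with (- alpha + beta) by ring. rewrite Rpower_plus.
    apply Rle_trans with (2 * u_s n k p r * Rpower r beta); [apply Rmult_le_compat_r; lra|].
    unfold u_s; fold alpha; right; ring.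
  - apply (vanishing_of_bounded (fun _ => 1) (beta - alpha) 1 1); [exact Hab|lra|intros; lra].
Qed.

(** The limit [lambda] acts from both sides: the upper bound on [u] makes [Y] small, the positive
    lower bound keeps [X] at most [(n - 2k) / k]. *)
Lemma stable_on_fast_decay (n k : nat) (p lambda : R) (u : R -> R) :
  (0 < k)%nat -> (2 * k < n)%nat -> p_se n k < p -> 0 < lambda -> sol11 n k p u ->
  vanishes_at_0 (fun r => u r * Rpower r ((INR n - 2 * INR k) / INR k)) ->
  (forall eps, 0 < eps -> exists M, forall r, M < r ->
     Rabs (u r * Rpower r ((INR n - 2 * INR k) / INR k) - lambda) < eps) ->
  exists R0, 0 < R0 /\ stable_on n k p u R0.
Proof.
  intros Hk Hn Hse Hl Hsol Hv Hlim.
  pose proof (INR_dimension_gap n k Hn) as HN. assert (Hk0 : 0 < INR k) by now apply lt_0_INR.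
  assert (HK : 0 < INR k / Cnk n k) by (apply Rdiv_lt_0_compat; [lra|apply Cnk_pos]).
  assert (Hp : 0 < p).
  { apply Rlt_trans with (p_se n k); [|exact Hse].
    apply Rdiv_lt_0_compat; [apply Rmult_lt_0_compat|]; lra. }
  destruct (profile_of_sol11 n k p u Hk Hn Hsol Hv) as (v & H & _).
  destruct (Hlim (lambda / 2) ltac:(lra)) as (M & HM).
  destruct (emden_Y_small_of_fast_decay n k p (INR k / Cnk n k) (2 * lambda) M
    ((INR n - 2 * INR k) / (4 * p)) u v) as (M2 & HM2 & HY); auto.
  - intros r Hr; specialize (HM r Hr); apply Rabs_def2 in HM; lra.
  - apply Rdiv_lt_0_compat; lra.
  - exists (M2 + 1); split; [lra|].
    apply (stable_on_of_small_Y n k p _ u v); auto; [lra| |].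
    + intros r Hr.
      apply (emden_X_le_of_slow_decay n k p (INR k / Cnk n k) (lambda / 2) M u v); auto; [lra| |lra].
      intros x Hx; specialize (HM x Hx); apply Rabs_def2 in HM; lra.
    + intros r Hr; apply HY; lra.
Qed.

Theorem theorem1p5 (n k : nat) (p : R) :
  (3 <= n)%nat -> (1 < k)%nat -> (2 * k < n)%nat ->
  ((p = p_so n k \/ (p_star n k <= p /\ ge_p_jl n k p)) ->
     forall (rho : R) (u : R -> R), 0 < rho -> regular_sol16 n k p rho u ->
       exists R0, 0 < R0 /\ stable_on n k p u R0)
  /\
  (p_se n k < p < p_so n k ->
     forall (Us : R -> R) (lambda : R), 0 < lambda ->
       sol11 n k p Us ->
       (forall eps, 0 < eps -> exists delta, 0 < delta /\
          forall r, 0 < r < delta -> Rabs (Us r / u_s n k p r - 1) < eps) ->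
       (forall eps, 0 < eps -> exists M, forall r, M < r ->
          Rabs (Us r * Rpower r ((INR n - 2 * INR k) / INR k) - lambda) < eps) ->
       exists R0, 0 < R0 /\ stable_on n k p Us R0).
Proof.
  intros _ Hk1 Hn; assert (Hk : (0 < k)%nat) by lia. split.
  - intros [->|[Hstar Hjl]] rho u _ Hreg.
    + exact (stable_on_critical n k rho u Hk Hn Hreg).
    (* The bound [X < Xs] holds on all of [(0, oo)], so the radius 1 is an arbitrary choice. *)
    + exists 1; split; [exact Rlt_0_1|].
      apply (stable_on_joseph_lundgren n k p rho u Hk Hn); auto.
      pose proof (p_so_le_p_star n k Hk Hn); lra.
  - intros [Hse _] Us lambda Hl Hsol H0 Hinf.
    apply (stable_on_fast_decay n k p lambda Us Hk Hn Hse Hl Hsol); auto.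
    apply (singular_vanishing n k p Us Hk Hn Hse); [apply Hsol|exact H0].
Qed.
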